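(* For every $\varepsilon>0$ there exist a weighted graph $G=(V,E,w)$ with no self-loops and an optimal solution $f_{\mathrm{SDP}}:V\to S^{N-1}$ ($N=|V|$) of $\mathrm{SDP}_{\mathrm{Prod}}(G)$ such that, if $\mathbf{Z}$ is a $3\times N$ matrix of i.i.d. standard Gaussians, \[\mathbb{E}_{\mathbf{Z}}\,\mathbb{E}_{(\mathbf{u},\mathbf{v})\sim E}\Big[\tfrac14-\tfrac14\Big\langle\tfrac{\mathbf{Z}f_{\mathrm{SDP}}(\mathbf{u})}{\|\mathbf{Z}f_{\mathrm{SDP}}(\mathbf{u})\|},\tfrac{\mathbf{Z}f_{\mathrm{SDP}}(\mathbf{v})}{\|\mathbf{Z}f_{\mathrm{SDP}}(\mathbf{v})\|}\Big\rangle\Big]\le(\alpha_{\mathrm{BOV}}+\varepsilon)\,\mathrm{Prod}(G).\]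
   Context: A weighted graph $G=(V,E,w)$ is a finite undirected graph with nonnegative edge weights summing to $1$; $(\mathbf{u},\mathbf{v})\sim E$ is a random edge. $\mathrm{Prod}(G)=\max_{f:V\to S^2}\mathbb{E}_{(\mathbf{u},\mathbf{v})\sim E}[\tfrac14-\tfrac14\langle f(\mathbf{u}),f(\mathbf{v})\rangle]$ (the product state value of the Quantum Max-Cut instance on $G$), and $\mathrm{SDP}_{\mathrm{Prod}}(G)=\max_{f:V\to S^{N-1}}\mathbb{E}_{(\mathbf{u},\mathbf{v})\sim E}[\tfrac14-\tfrac14\langle f(\mathbf{u}),f(\mathbf{v})\rangle]$. For $k\ge1$ and $\rho\in[-1,1]$, $F^*(k,\rho)=\mathbb{E}\big\langle \mathbf{Z}u/\|\mathbf{Z}u\|,\mathbf{Z}v/\|\mathbf{Z}v\|\big\rangle$ where $u,v\in\mathbb{R}^m$ ($m\ge2$) are unit vectors with $\langle u,v\rangle=\rho$ and $\mathbf{Z}$ is a $k\times m$ matrix of i.i.d. standard Gaussians (this depends only on $k,\rho$; explicitly $F^*(k,\rho)=\frac2k\big(\frac{\Gamma((k+1)/2)}{\Gamma(k/2)}\big)^2\rho\,{}_2F_1(\tfrac12,\tfrac12;\tfrac k2+1;\rho^2)$). $\alpha_{\mathrm{BOV}}=\min_{-1\le\rho<1}\frac{\frac14-\frac14F^*(3,\rho)}{\frac14-\frac14\rho}$ ($\approx0.956$). *)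

(* Defs.v *)
From HB Require Import structures.
From mathcomp Require Import all_boot all_order all_algebra.
From mathcomp Require Import all_classical all_reals all_analysis.
Set Implicit Arguments. Unset Strict Implicit. Unset Printing Implicit Defensive.
Import Order.TTheory GRing.Theory Num.Theory.
Import numFieldNormedType.Exports.
Local Open Scope classical_set_scope.
Local Open Scope ring_scope.

Section Defs.
Variable R : realType.

Definition dotp (k : nat) (x y : 'I_k -> R) : R := \sum_(i < k) x i * y i.
Definition vnorm (k : nat) (x : 'I_k -> R) : R := Num.sqrt (dotp x x).
Definition unit_sphere (k : nat) (x : 'I_k -> R) : Prop := vnorm x = 1.

(* x / ||x|| (0 when x = 0, a null event below) *)
Definition normalize (k : nat) (x : 'I_k -> R) : 'I_k -> R :=
  fun i => x i / vnorm x.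

Definition mxvec_mul (k m : nat) (Z : 'M[R]_(k, m)) (x : 'I_m -> R) : 'I_k -> R :=
  fun i => \sum_(j < m) Z i j * x j.

(* Expectation of F(g) where g_0, g_1, ..., g_{n-1} are i.i.d. standard
   Gaussians (g_i for i >= n is set to 0), as an iterated Lebesgue integral
   against the N(0,1) density. *)
Fixpoint gauss_exp (n : nat) (F : (nat -> R) -> R) : R :=
  match n with
  | 0 => F (fun _ => 0)
  | n'.+1 => \int[@lebesgue_measure R]_(x in [set: R])
               (normal_pdf 0 1 x *
                gauss_exp n' (fun g => F (fun i => if i == 0%N then x else g i.-1)))
  end.

Definition gauss_mx_exp (k m : nat) (F : 'M[R]_(k, m) -> R) : R :=
  gauss_exp (k * m) (fun g => F (\matrix_(i < k, j < m) g (i * m + j)%N)).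

(* A weighted graph on V = 'I_N: weights on (ordered) vertex pairs,
   nonnegative, summing to 1; (u,v) ~ E is drawn with probability w u v. *)
Definition weighted_graph (N : nat) (w : 'I_N -> 'I_N -> R) : Prop :=
  (forall u v, 0 <= w u v) /\ \sum_(u < N) \sum_(v < N) w u v = 1.

Definition no_self_loops (N : nat) (w : 'I_N -> 'I_N -> R) : Prop :=
  forall u, w u u = 0.

Definition edge_exp (N : nat) (w : 'I_N -> 'I_N -> R) (h : 'I_N -> 'I_N -> R) : R :=
  \sum_(u < N) \sum_(v < N) w u v * h u v.

Definition prod_val (N k : nat) (w : 'I_N -> 'I_N -> R) (f : 'I_N -> 'I_k -> R) : R :=
  edge_exp w (fun u v => 1/4 - 1/4 * dotp (f u) (f v)).

Definition Prod (N : nat) (w : 'I_N -> 'I_N -> R) : R :=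
  sup [set prod_val w f | f in [set f : 'I_N -> 'I_3 -> R |
                                  forall u, unit_sphere (f u)]].

Definition SDP_Prod_optimal (N : nat) (w : 'I_N -> 'I_N -> R)
    (f : 'I_N -> 'I_N -> R) : Prop :=
  (forall u, unit_sphere (f u)) /\
  (forall g : 'I_N -> 'I_N -> R, (forall u, unit_sphere (g u)) ->
     prod_val w g <= prod_val w f).

Definition Fstar (k : nat) (rho : R) : R :=
  let u : 'I_2 -> R := fun i => if i == ord0 then 1 else 0 in
  let v : 'I_2 -> R := fun i => if i == ord0 then rho else Num.sqrt (1 - rho ^+ 2) in
  gauss_mx_exp (fun Z : 'M[R]_(k, 2) =>
     dotp (normalize (mxvec_mul Z u)) (normalize (mxvec_mul Z v))).

(* alpha_BOV = min_{-1 <= rho < 1} ... (taken as an infimum) *)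
Definition alpha_BOV : R :=
  inf [set (1/4 - 1/4 * Fstar 3 rho) / (1/4 - 1/4 * rho) | rho in
         [set rho : R | -1 <= rho /\ rho < 1]].

End Defs.

(* Main.v *)
Require Import Defs.
From HB Require Import structures.
From mathcomp Require Import all_boot all_order all_algebra.
From mathcomp Require Import all_classical all_reals all_analysis.
From mathcomp Require Import measurable_realfun.
From mathcomp Require Import ring lra.
Set Implicit Arguments. Unset Strict Implicit. Unset Printing Implicit Defensive.
Import Order.TTheory GRing.Theory Num.Theory.
Import numFieldNormedType.Exports.
Local Open Scope classical_set_scope.
Local Open Scope ring_scope.

(* Take the noisy hypercube: vertices {-1,1}^d, with weight
   2^-d prod_i (1 + rho x_i y_i)/2 on the pair (x, y), for rho <= 0, and delete
   the self-loops.  The noise operator has eigenvalues rho^|S|, the least of which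
   is rho; hence x |-> x / sqrt d is an optimal SDP solution, and the dictator
   x |-> (x_1, 0, 0) is an assignment into S^2 with the same value, so that Prod
   equals the SDP value.  Deleting the self-loops only shifts the quadratic form
   by a multiple of the identity and keeps both facts.  By rotation invariance of
   the Gaussian measure, an edge (x, y) is rounded to correlation
   F*(3, <x, y> / d) on average, and <x, y> / d concentrates around rho as d
   grows, so by continuity of F* the ratio tends to the one defining alpha_BOV.
   For rho >= 0 the ratio is at least 1: rounding cannot beat the SDP optimum on
   the cube with parameter -rho, so -rho <= F*(3, -rho) = - F*(3, rho). *)

(** * Bounded measurable functions *)

Section bounded_measurable.
Context {d : measure_display} {T : measurableType d} {R : realType}.

(** The class of integrands used throughout: under a probability measure they are integrable, and
    the class is stable under measurable substitution and partial integration, so Fubini and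
    linearity apply without further side conditions. *)
Definition bounded_measurable (f : T -> R) :=
  measurable_fun setT f /\ exists M, forall x, `|f x| <= M.

Lemma bounded_measurable_integrable (P : probability T R) (f : T -> R) :
  bounded_measurable f -> P.-integrable setT (EFin \o f).
Proof.
move=> [mf [M fM]]; apply: measurable_bounded_integrable => //.
  by rewrite -ge0_fin_numE// fin_num_measure.
exists M; split; first exact: num_real.
by move=> y My x _; exact: le_trans (fM x) (ltW My).
Qed.

Lemma Rintegral_probability_cst (P : probability T R) (c : R) :
  \int[P]_x c = c.
Proof.
rewrite Rintegral_cst// -[RHS]mulr1; congr (_ * _).
by apply: (congr1 fine (probability_setT P)).
Qed.

Lemma Rintegral_probability_le (P : probability T R) (f : T -> R) M :
  measurable_fun setT f -> (forall x, `|f x| <= M) -> `|\int[P]_x f x| <= M.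
Proof.
move=> mf fM.
have If : P.-integrable setT (EFin \o f).
  by apply: bounded_measurable_integrable; split => //; exists M.
apply: le_trans (le_normr_Rintegral measurableT If) _.
rewrite -[leRHS](Rintegral_probability_cst P); apply: le_Rintegral => //.
  apply: bounded_measurable_integrable; split; first exact: measurableT_comp.
  by exists M => x; rewrite normr_id.
apply: bounded_measurable_integrable; split => //; exists `|M| => x; exact: lexx.
Qed.

End bounded_measurable.

Lemma bounded_measurable_comp {d d' : measure_display} {T : measurableType d}
    {T' : measurableType d'} {R : realType} (f : T -> R) (h : T' -> T) :
  bounded_measurable f -> measurable_fun setT h -> bounded_measurable (f \o h).
Proof.
move=> [mf [M fM]] mh; split; first exact: measurableT_comp.
by exists M => x; exact: fM.
Qed.

(** * Fubini for bounded integrands *)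

Section fubini_bounded.
Context {d1 d2 : measure_display} {T1 : measurableType d1}
  {T2 : measurableType d2} {R : realType}.
Variables (P1 : probability T1 R) (P2 : probability T2 R).

Lemma bounded_measurable_Rintegral2 (f : T1 * T2 -> R) :
  bounded_measurable f -> bounded_measurable (fun x => \int[P2]_y f (x, y)).
Proof.
move=> [mf [M fM]]; split.
  apply: (measurableT_comp (fine_measurable measurableT)).
  rewrite (_ : (fun x => _) = fubini_F P2 (EFin \o f))//.
  apply: (measurable_fubini_F (m1 := P1)).
  by apply: bounded_measurable_integrable; split => //; exists M.
exists M => x; apply: Rintegral_probability_le => //.
exact: measurable_fun_pair2.
Qed.

Lemma Rintegral_prod (f : T1 * T2 -> R) : bounded_measurable f ->
  \int[(P1 \x P2)%E]_z f z = \int[P1]_x \int[P2]_y f (x, y).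
Proof.
move=> bf.
have If := bounded_measurable_integrable (P1 \x P2)%E bf.
rewrite {1}/Rintegral -integral12_prod_meas1//; congr fine.
apply: eq_integral => x _; rewrite fineK//.
apply: integrable_fin_num => //.
apply: (bounded_measurable_integrable P2 (f := fun y => f (x, y))).
by apply: bounded_measurable_comp => //; exact: pair1_measurable.
Qed.

Lemma Rintegral_swap (f : T1 * T2 -> R) : bounded_measurable f ->
  \int[P1]_x \int[P2]_y f (x, y) = \int[P2]_y \int[P1]_x f (x, y).
Proof.
move=> bf.
have If := bounded_measurable_integrable (P1 \x P2)%E bf.
rewrite -Rintegral_prod// /Rintegral -integral21_prod_meas1//; congr fine.
apply: eq_integral => y _; rewrite fineK//.
apply: integrable_fin_num => //.
apply: (bounded_measurable_integrable P1 (f := fun x => f (x, y))).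
by apply: bounded_measurable_comp => //; exact: pair2_measurable.
Qed.

End fubini_bounded.

(** * Gaussian measure *)

Section normal_expectation.
Context {R : realType}.
Local Notation mu := (@lebesgue_measure R).

(** The Radon-Nikodym derivative of [normal_prob] agrees almost everywhere with [normal_pdf], since
    both have the same integral over every measurable set. *)
Lemma integral_normal_prob (m s : R) (f : R -> \bar R) :
  (normal_prob m s).-integrable setT f ->
  (\int[normal_prob m s]_x f x = \int[mu]_x (f x * (normal_pdf m s x)%:E))%E.
Proof.
move=> If; have mf := measurable_int _ If.
have dom : normal_prob m s `<< mu by exact: normal_prob_dominates.
have mpdf : measurable_fun setT (EFin \o normal_pdf m s).
  by apply/measurable_EFinP; exact: measurable_normal_pdf.
rewrite -(Radon_Nikodym_change_of_variables dom)//=.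
apply: ae_eq_integral => //.
- exact: emeasurable_funM.
- exact: emeasurable_funM.
- apply: ae_eqe_mul2l => /=.
  rewrite Radon_NikodymE//=; case: cid => /= h [h1 h2 h3].
  apply: integral_ae_eq => //=.
  by move=> E _ mE; rewrite -h3.
Qed.

Lemma Rintegral_normal_prob (m s : R) (f : R -> R) : bounded_measurable f ->
  \int[mu]_x (normal_pdf m s x * f x) = \int[normal_prob m s]_x f x.
Proof.
move=> bf; rewrite /Rintegral integral_normal_prob; last first.
  exact: bounded_measurable_integrable.
by congr fine; apply: eq_integral => x _; rewrite -EFinM mulrC.
Qed.

(** The pushforward of Lebesgue measure under a translation gives half-open intervals their length,
    so uniqueness of Lebesgue measure applies. *)
Lemma lebesgue_measure_translation (a : R) (A : set R) : measurable A ->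
  mu A = mu ((fun x => x + a) @^-1` A).
Proof.
have ma : measurable_fun setT (fun x : R => x + a) by exact: measurable_funD.
move=> mA.
pose sh (x : measurableTypeR R) : measurableTypeR R := x + a.
pose nu := measure_function_pushforward__canonical__measure_function_Measure mu
  (ma : measurable_fun setT sh).
rewrite -[RHS]/(nu A); apply: lebesgue_measure_unique => //.
move=> X [[b c] _ <-]; rewrite -[RHS]/(mu ((fun x => x + a) @^-1` `]b, c]%classic)).
have -> : (fun x => x + a) @^-1` `]b, c]%classic = `]b - a, c - a]%classic.
  by apply/seteqP; split => x /=; rewrite !in_itv/= ltrBlDr lerBrDr.
rewrite [LHS]lebesgue_measure_itv [RHS]lebesgue_measure_itv/= !lte_fin ltrD2r.
by case: ifP => // _; rewrite -!EFinB; congr EFin; ring.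
Qed.

Lemma ge0_integral_translation (a : R) (f : R -> \bar R) :
  measurable_fun setT f -> (forall x, 0 <= f x)%E ->
  (\int[mu]_x f (x + a)%R = \int[mu]_x f x)%E.
Proof.
move=> mf f0.
have ma : measurable_fun setT (fun x : R => x + a) by exact: measurable_funD.
pose sh (x : measurableTypeR R) : measurableTypeR R := x + a.
rewrite -[LHS]/(\int[mu]_(x in sh @^-1` setT) (f \o sh) x)%E.
rewrite -(@ge0_integral_pushforward _ _ _ _ _ sh ma mu setT f)//.
apply: eq_measure_integral => A mA _.
by rewrite [RHS](lebesgue_measure_translation a).
Qed.

End normal_expectation.

(** * Rotation invariance of the Gaussian measure on the plane *)

Section gaussian_rotation.
Context {R : realType}.
Local Notation mu := (@lebesgue_measure R).
Local Notation phi := (@normal_pdf R 0 1).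
Local Notation gamma := (normal_prob 0 1 : probability (measurableTypeR R) R).

Lemma ge0_integral_shear2 (t : R) (K : R * R -> \bar R) :
  measurable_fun setT K -> (forall z, 0 <= K z)%E ->
  (\int[mu]_x \int[mu]_y K (x, y + t * x)%R = \int[mu]_x \int[mu]_y K (x, y))%E.
Proof.
move=> mK K0; apply: eq_integral => x _.
rewrite (ge0_integral_translation (t * x) (f := fun y => K (x, y)))//.
exact: measurable_fun_pair2.
Qed.

(** The translated variable is the outer one here, so Tonelli exchanges the integrals before
    translation invariance is used. *)
Lemma ge0_integral_shear1 (t : R) (K : R * R -> \bar R) :
  measurable_fun setT K -> (forall z, 0 <= K z)%E ->
  (\int[mu]_x \int[mu]_y K (x + t * y, y)%R = \int[mu]_x \int[mu]_y K (x, y))%E.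
Proof.
move=> mK K0.
pose Kt (z : measurableTypeR R * measurableTypeR R) := K (z.1 + t * z.2, z.2).
have mKt : measurable_fun setT Kt.
  apply: measurableT_comp => //; apply: measurable_fun_pair => //.
  by apply: measurable_funD => //; exact: measurable_funM.
apply: etrans (fubini_tonelli (m1 := mu) (m2 := mu) Kt mKt (fun z => K0 _)) _.
apply: etrans _ (esym (fubini_tonelli (m1 := mu) (m2 := mu) K mK K0)).
apply: eq_integral => y _.
apply: (ge0_integral_translation (t * y) (f := fun x => K (x, y))) => //.
exact: measurable_fun_pair1.
Qed.

Lemma normal_pdf_mul (x y x' y' : R) : x ^+ 2 + y ^+ 2 = x' ^+ 2 + y' ^+ 2 ->
  phi x * phi y = phi x' * phi y'.
Proof.
move=> e; rewrite !normal_pdfE ?oner_neq0// /normal_fun.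
rewrite [LHS]mulrACA [RHS]mulrACA -!expRD; congr (_ * expR _).
by rewrite !subr0 -!mulrDl -!opprD e.
Qed.

Lemma bounded_measurable_normal2 (H : R * R -> R) : bounded_measurable H ->
  bounded_measurable (fun x => \int[gamma]_y H (x, y)).
Proof. by move=> bH; exact: (bounded_measurable_Rintegral2 gamma gamma bH). Qed.

(** Brings a Gaussian double integral into the form of a nonnegative Lebesgue integral, to which the
    shear lemmas apply. *)
Lemma ge0_integral_normal2 (H : R * R -> R) :
  bounded_measurable H -> (forall z, 0 <= H z) ->
  (\int[mu]_x \int[mu]_y (phi x * phi y * H (x, y))%:E =
   (\int[gamma]_x \int[gamma]_y H (x, y))%:E)%E.
Proof.
move=> bH H0; have [mH _] := bH.
have bHx x : bounded_measurable (fun y => H (x, y)).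
  by apply: (bounded_measurable_comp bH); exact: pair1_measurable.
have bh := bounded_measurable_normal2 bH.
transitivity (\int[mu]_x ((\int[gamma]_y H (x, y))%:E * (phi x)%:E))%E.
  apply: eq_integral => x _.
  under eq_integral do rewrite -mulrA EFinM.
  rewrite ge0_integralZl//=; last 3 first.
  - apply/measurable_EFinP; apply: measurable_funM => //.
      exact: measurable_normal_pdf.
    exact: (bHx x).1.
  - by move=> y _; rewrite lee_fin mulr_ge0// normal_pdf_ge0.
  - by rewrite lee_fin normal_pdf_ge0.
  rewrite muleC; congr (_ * _)%E.
  rewrite /Rintegral fineK; last first.
    exact: integrable_fin_num (bounded_measurable_integrable gamma (bHx x)).
  rewrite integral_normal_prob; last first.
    exact: (bounded_measurable_integrable gamma (bHx x)).
  by apply: eq_integral => y _; rewrite -EFinM mulrC.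
rewrite -integral_normal_prob; last exact: (bounded_measurable_integrable gamma bh).
rewrite /Rintegral fineK//.
exact: integrable_fin_num (bounded_measurable_integrable gamma bh).
Qed.

(* A rotation with [c != -1] is a product of three shears, and shears preserve
   Lebesgue measure by Fubini and translation invariance. *)
Lemma ge0_normal_rotation (c s : R) (H : R * R -> R) :
  c ^+ 2 + s ^+ 2 = 1 -> c != -1 -> bounded_measurable H ->
  (forall z, 0 <= H z) ->
  \int[gamma]_x \int[gamma]_y H (c * x - s * y, s * x + c * y) =
  \int[gamma]_x \int[gamma]_y H (x, y).
Proof.
move=> cs1 cN1 bH H0; have [mH _] := bH.
have c1 : 1 + c != 0 by rewrite addrC -(opprK 1) subr_eq0.
(* For [c] and [s] the cosine and sine of an angle, [t] is the tangent of half of it. The identities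
   [tc] and [ts] make the shears with parameters [- t], [s], [- t] compose to the rotation. *)
pose t := s / (1 + c).
have tc : t * (1 + c) = s by rewrite /t divfK.
have ts : 1 - t * s = c.
  apply: (mulIf c1); rewrite mulrBl mul1r mulrAC tc.
  rewrite mulrDr mulr1; nra.
pose rot (z : R * R) := (c * z.1 - s * z.2, s * z.1 + c * z.2).
have mrot : measurable_fun setT rot.
  by apply: measurable_fun_pair; [apply: measurable_funB|apply: measurable_funD];
    exact: measurable_funM.
have brot : bounded_measurable (H \o rot) by exact: bounded_measurable_comp.
apply: EFin_inj; apply: etrans _ (ge0_integral_normal2 bH H0).
apply: etrans (esym (ge0_integral_normal2 brot (fun z => H0 (rot z)))) _.
pose K z : \bar R := (phi z.1 * phi z.2 * H z)%:E.
have mK : measurable_fun setT K.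
  apply/measurable_EFinP/measurable_funM => //.
  by apply: measurable_funM; apply: measurableT_comp => //;
    exact: measurable_normal_pdf.
have K0 z : (0 <= K z)%E by rewrite lee_fin !mulr_ge0// normal_pdf_ge0.
have m1 (a : R) : measurable_fun setT (fun z : R * R => (z.1 + a * z.2, z.2)).
  apply: measurable_fun_pair => //.
  by apply: measurable_funD => //; exact: measurable_funM.
have m2 (a : R) : measurable_fun setT (fun z : R * R => (z.1, z.2 + a * z.1)).
  apply: measurable_fun_pair => //.
  by apply: measurable_funD => //; exact: measurable_funM.
pose S1 (z : R * R) := (z.1 + - t * z.2, z.2).
pose S2 (z : R * R) := (z.1, z.2 + s * z.1).
have mK1 : measurable_fun setT (K \o S1) by apply: measurableT_comp => //; exact: m1.
have mK2 : measurable_fun setT (K \o S1 \o S2).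
  by apply: measurableT_comp => //; exact: m2.
apply: etrans _ (ge0_integral_shear1 (- t) mK K0).
apply: etrans _ (ge0_integral_shear2 s mK1 (fun z => K0 (S1 z))).
apply: etrans _ (ge0_integral_shear1 (- t) mK2 (fun z => K0 (S1 (S2 z)))).
apply: eq_integral => x _; apply: eq_integral => y _.
rewrite /K/= /S2 /S1 /rot/=.
have -> : y + s * (x + - t * y) = s * x + c * y by rewrite -ts; ring.
have -> : x + - t * y + - t * (s * x + c * y) = c * x - s * y.
  by transitivity ((1 - t * s) * x - t * (1 + c) * y); [ring|rewrite ts tc].
congr (_ * _)%:E; apply: normal_pdf_mul.
transitivity ((c ^+ 2 + s ^+ 2) * (x ^+ 2 + y ^+ 2)); [by rewrite cs1 mul1r|ring].
Qed.

(** If [M] bounds [H] in absolute value, then [H + M] is nonnegative, and adding [M] shifts both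
    sides by [M] because [gamma] has mass one. *)
Lemma normal_rotation (c s : R) (H : R * R -> R) :
  c ^+ 2 + s ^+ 2 = 1 -> c != -1 -> bounded_measurable H ->
  \int[gamma]_x \int[gamma]_y H (c * x - s * y, s * x + c * y) =
  \int[gamma]_x \int[gamma]_y H (x, y).
Proof.
move=> cs1 cN1 bH; have [mH [M HM]] := bH.
have shiftM (h : R * R -> R) : bounded_measurable h ->
    \int[gamma]_x \int[gamma]_y (h (x, y) + M) =
    \int[gamma]_x \int[gamma]_y h (x, y) + M.
  move=> bh.
  have bM : forall T : measurableType _,  bounded_measurable (fun _ : T => M).
    by move=> T; split => //; exists `|M|.
  rewrite -[X in _ = _ + X](Rintegral_probability_cst gamma).
  rewrite -RintegralD//; last 2 first.
  - by apply: bounded_measurable_integrable; exact: bounded_measurable_normal2.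
  - by apply: bounded_measurable_integrable; exact: bM.
  apply: eq_Rintegral => x _.
  rewrite RintegralD ?Rintegral_probability_cst//.
  - apply: (bounded_measurable_integrable gamma (f := fun y => h (x, y))).
    by apply: (bounded_measurable_comp bh); exact: pair1_measurable.
  - by apply: bounded_measurable_integrable; exact: bM.
have mrot : measurable_fun setT (fun z => (c * z.1 - s * z.2, s * z.1 + c * z.2)).
  by apply: measurable_fun_pair; [apply: measurable_funB|apply: measurable_funD];
    exact: measurable_funM.
have := @ge0_normal_rotation c s (fun z => H z + M) cs1 cN1.
rewrite shiftM// (shiftM (H \o
    (fun z => (c * z.1 - s * z.2, s * z.1 + c * z.2)))); last first.
  exact: bounded_measurable_comp.
move=> E; apply: (addIr M); apply: E.
  split; first exact: measurable_funD.
  exists (M + `|M|) => z; apply: le_trans (ler_normD _ _) _; exact: lerD.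
by move=> z; have := HM z; rewrite ler_norml => /andP[]; lra.
Qed.

End gaussian_rotation.

(** * Projections of Gaussian vectors *)

Section gauss_exp_theory.
Context {R : realType}.
Local Notation mu := (@lebesgue_measure R).
Local Notation gamma := (normal_prob 0 1 : probability (measurableTypeR R) R).

(** The sign condition [0 <= c] excludes the half turn [c = -1], at which the factorization into
    shears breaks down. *)
Lemma polar_decomposition (a p : R) : 0 <= p -> exists P c s : R,
  [/\ 0 <= P, P ^+ 2 = a ^+ 2 + p ^+ 2, p = P * c, a = P * s &
      c ^+ 2 + s ^+ 2 = 1 /\ 0 <= c].
Proof.
move=> p0; pose P := Num.sqrt (a ^+ 2 + p ^+ 2).
have P2 : P ^+ 2 = a ^+ 2 + p ^+ 2 by rewrite sqr_sqrtr// addr_ge0// sqr_ge0.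
have P0 : 0 <= P by exact: sqrtr_ge0.
have [Pe|Pn] := eqVneq P 0.
  have : a ^+ 2 + p ^+ 2 == 0 by rewrite -P2 Pe expr0n.
  rewrite paddr_eq0 ?sqr_ge0// !sqrf_eq0 => /andP[/eqP a0 /eqP pe].
  exists P, 1, 0; rewrite P2 Pe a0 pe !mul0r; split => //.
  by rewrite expr1n expr0n addr0.
exists P, (p / P), (a / P); split => //; try by rewrite mulrC divfK.
split; last exact: divr_ge0.
by rewrite !expr_div_n -mulrDl addrC -P2 divff// expf_neq0.
Qed.

(* In the induction step, two planar rotations absorb the extra Gaussian into the
   two that are already there. *)
Lemma gauss_exp_linear2 (N : nat) (a b : nat -> R) : exists p q r : R,
  [/\ 0 <= p /\ 0 <= r, p ^+ 2 = \sum_(i < N) a i ^+ 2,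
      p * q = \sum_(i < N) a i * b i,
      q ^+ 2 + r ^+ 2 = \sum_(i < N) b i ^+ 2 &
      forall H : R * R -> R, bounded_measurable H ->
      gauss_exp N (fun g => H (\sum_(i < N) g i * a i, \sum_(i < N) g i * b i)) =
      \int[gamma]_x \int[gamma]_y H (p * x, q * x + r * y)].
Proof.
elim: N a b => [|N IH] a b.
  exists 0, 0, 0; rewrite !big_ord0 expr0n mul0r addr0; split => // H bH /=.
  rewrite !big_ord0; under eq_Rintegral do under eq_Rintegral do
    rewrite !mul0r addr0.
  under eq_Rintegral do rewrite Rintegral_probability_cst.
  by rewrite Rintegral_probability_cst.
have [p [q [r [[p0 r0] pE pqE qrE EH]]]] := IH (a \o S) (b \o S).
have [P [c [s [P0 PE pc as_ [cs1 c0]]]]] := polar_decomposition (a 0%N) p0.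
(* With [u = c x - s y] and [v = s x + c y], the first linear form becomes [P v] and the second
   gains [al u + be v]. *)
pose al := b 0%N * c - q * s.
pose be := b 0%N * s + q * c.
(* The second rotation merges [al u + r z] into a single Gaussian with coefficient [r']. *)
have [r' [c2 [s2 [r'0 r'E rc2 als2 [cs21 c20]]]]] := polar_decomposition al r0.
exists P, be, r'; rewrite !big_ord_recl/=; split => //.
- by rewrite PE pE.
- rewrite -pqE /be mulrDr mulrCA -as_ [X in _ + X]mulrCA -pc [b 0%N * _]mulrC.
  by congr (_ + _); exact: mulrC.
- rewrite -qrE r'E !addrA; congr (_ + _).
  rewrite /al /be; transitivity ((b 0%N ^+ 2 + q ^+ 2) * (c ^+ 2 + s ^+ 2)).
    by ring.
  by rewrite cs1 mulr1.
move=> H bH.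
have cN1 : c != -1 by apply/eqP => ce; move: c0; rewrite ce; lra.
have c2N1 : c2 != -1 by apply/eqP => ce; move: c20; rewrite ce; lra.
pose A0 := a 0%N; pose B0 := b 0%N.
pose K3 (z : (R * R) * R) :=
  H (P * z.1.2, be * z.1.2 + (al * z.1.1 + r * z.2)).
have bK3 : bounded_measurable K3.
  apply: (bounded_measurable_comp bH); apply: measurable_fun_pair => /=.
    by apply: measurable_funM => //; exact: measurableT_comp.
  by apply: measurable_funD; [|apply: measurable_funD];
    apply: measurable_funM => //; exact: measurableT_comp.
pose K (z : R * R) := \int[gamma]_y K3 (z, y).
have bK : bounded_measurable K.
  exact: (bounded_measurable_Rintegral2 (gamma \x gamma)%E gamma bK3).
pose rot (z : R * R) := (c * z.1 - s * z.2, s * z.1 + c * z.2).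
have mrot : measurable_fun setT rot.
  by apply: measurable_fun_pair; [apply: measurable_funB|apply: measurable_funD];
    exact: measurable_funM.
have bKrot : bounded_measurable (K \o rot) by exact: bounded_measurable_comp.
transitivity (\int[gamma]_x \int[gamma]_y (K \o rot) (x, y)).
  rewrite -Rintegral_normal_prob; last exact: bounded_measurable_normal2.
  apply: eq_Rintegral => x _; congr (_ * _).
  pose Hx (z : R * R) := H (A0 * x + z.1, B0 * x + z.2).
  have bHx : bounded_measurable Hx.
    apply: (bounded_measurable_comp bH).
    by apply: measurable_fun_pair; exact: measurable_funD.
  transitivity (gauss_exp N (fun g =>
      Hx (\sum_(i < N) g i * a i.+1, \sum_(i < N) g i * b i.+1))).
    by congr gauss_exp; apply/funext => g; rewrite /Hx /= !big_ord_recl/= ![x * _]mulrC.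
  rewrite (EH _ bHx); apply: eq_Rintegral => y _; rewrite /K /rot /Hx/=.
  apply: eq_Rintegral => z _; rewrite /K3/=; congr (H (_, _)).
    by rewrite /A0 as_ pc; ring.
  rewrite [RHS]addrA [LHS]addrA; congr (_ + _).
  transitivity (b 0%N * x * (c ^+ 2 + s ^+ 2) + q * y * (c ^+ 2 + s ^+ 2)).
    by rewrite cs1 !mulr1.
  by rewrite /al /be; ring.
(* With [v] moved to the outside it can be frozen while the pair [(u, z)] is rotated. *)
rewrite (normal_rotation cs1 cN1 bK) (Rintegral_swap gamma gamma bK).
apply: eq_Rintegral => v _.
pose L (z : R * R) := H (P * v, be * v + r' * z.2).
have bL : bounded_measurable L.
  apply: (bounded_measurable_comp bH); apply: measurable_fun_pair => //.
  by apply: measurable_funD => //; exact: measurable_funM.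
transitivity (\int[gamma]_u \int[gamma]_z L (c2 * u - s2 * z, s2 * u + c2 * z)).
  apply: eq_Rintegral => u _; apply: eq_Rintegral => z _.
  by rewrite /K3 /L/=; congr (H (_, _ + _)); rewrite {1}als2 {1}rc2; ring.
rewrite (normal_rotation cs21 c2N1 bL).
(* [L] ignores its first argument, so one of the two Gaussians integrates out. *)
exact: (Rintegral_probability_cst gamma (\int[gamma]_y H (P * v, be * v + r' * y))).
Qed.

End gauss_exp_theory.

(** * Euclidean vectors *)

Section euclidean.
Context {R : realType}.

Lemma dotp_ge0 (k : nat) (x : 'I_k -> R) : 0 <= dotp x x.
Proof. by apply: sumr_ge0 => i _; rewrite -expr2 sqr_ge0. Qed.

Lemma dotp_normalize (k : nat) (x : 'I_k -> R) :
  dotp (normalize x) (normalize x) = (dotp x x != 0)%:R.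
Proof.
rewrite /dotp /normalize.
under eq_bigr do rewrite mulrACA; rewrite -mulr_suml -/(dotp x x).
rewrite -invfM -expr2 sqr_sqrtr ?dotp_ge0//.
by have [->|x0] := eqVneq (dotp x x) 0; rewrite ?mul0r ?divff.
Qed.

Lemma dotp_normalize_le1 (k : nat) (x : 'I_k -> R) :
  dotp (normalize x) (normalize x) <= 1.
Proof. by rewrite dotp_normalize; case: (_ != _). Qed.

(** Expand the squared norms of [x + y] and [x - y], both nonnegative. *)
Lemma ler_norm_dotp (k : nat) (x y : 'I_k -> R) :
  dotp x x <= 1 -> dotp y y <= 1 -> `|dotp x y| <= 1.
Proof.
move=> x1 y1.
have H (e : R) : e ^+ 2 = 1 -> - (2 * e * dotp x y) <= 2.
  move=> e1; have : 0 <= \sum_(i < k) (x i + e * y i) ^+ 2.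
    by apply: sumr_ge0 => i _; rewrite sqr_ge0.
  suff -> : \sum_(i < k) (x i + e * y i) ^+ 2 =
      dotp x x + 2 * e * dotp x y + dotp y y by lra.
  transitivity (dotp x x + 2 * e * dotp x y + e ^+ 2 * dotp y y).
    by rewrite /dotp !mulr_sumr -!big_split/=; apply: eq_bigr => i _; ring.
  by rewrite e1 mul1r.
have e1 : (-1 : R) ^+ 2 = 1 by rewrite sqrrN expr1n.
by rewrite ler_norml; have := H 1 (expr1n _ _); have := H (-1) e1; lra.
Qed.

Lemma ler_norm_dotp_normalize (k : nat) (x y : 'I_k -> R) :
  `|dotp (normalize x) (normalize y)| <= 1.
Proof. by apply: ler_norm_dotp; exact: dotp_normalize_le1. Qed.

Lemma unit_sphere_dotp (k : nat) (x : 'I_k -> R) :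
  unit_sphere x <-> dotp x x = 1.
Proof.
rewrite /unit_sphere /vnorm; split=> [e|->]; last by rewrite sqrtr1.
by rewrite -[LHS]sqr_sqrtr ?dotp_ge0// e expr1n.
Qed.

Lemma measurable_inv_real : measurable_fun [set: R] (@GRing.inv R).
Proof.
have -> : (@GRing.inv R) = (fun x => if x == 0 then 0 else x^-1).
  by apply/funext => x; case: eqP => // ->; rewrite invr0.
apply: measurable_fun_if => //.
  apply: (measurable_fun_bool true) => //; rewrite setTI.
  rewrite (_ : _ @^-1` _ = [set 0])//.
  by apply/seteqP; split => x /= /eqP.
rewrite setTI (_ : _ @^-1` _ = [set x : R | x != 0]); last first.
  by apply/seteqP; split => x /=; case: (x == 0).
apply: open_continuous_measurable_fun => //; apply/in_setP => x /= x0.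
exact: inv_continuous.
Qed.

Lemma measurable_dotp_normalize {d : measure_display} {T : measurableType d}
    (k : nat) (X Y : T -> 'I_k -> R) :
  (forall i, measurable_fun setT (fun t => X t i)) ->
  (forall i, measurable_fun setT (fun t => Y t i)) ->
  measurable_fun setT (fun t => dotp (normalize (X t)) (normalize (Y t))).
Proof.
have H (Z : T -> 'I_k -> R) : (forall i, measurable_fun setT (fun t => Z t i)) ->
    forall i, measurable_fun setT (fun t => normalize (Z t) i).
  move=> mZ i; apply: measurable_funM => //.
  apply: (measurableT_comp measurable_inv_real).
  apply: (@measurableT_comp _ _ _ _ _ _ (@Num.sqrt R)).
    by apply: continuous_measurable_fun; exact: sqrt_continuous.
  by apply: measurable_sum => j; exact: measurable_funM.
move=> mX mY; apply: measurable_sum => i.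
by apply: measurable_funM; exact: H.
Qed.

End euclidean.

(** * [gauss_exp] as an integral *)

Section gauss_exp_measure.
Context {R : realType}.
Local Notation mu := (@lebesgue_measure R).
Local Notation gamma := (normal_prob 0 1 : probability (measurableTypeR R) R).

Lemma gauss_exp_cat (m n : nat) (F : (nat -> R) -> R) :
  gauss_exp (m + n) F = gauss_exp m (fun g => gauss_exp n (fun h =>
    F (fun i => if (i < m)%N then g i else h (i - m)%N))).
Proof.
elim: m F => [|m IH] F /=.
  by rewrite add0n; congr gauss_exp; apply/funext => h; congr F; apply/funext => i;
    rewrite subn0.
apply: eq_Rintegral => x _; rewrite IH; congr (_ * _).
congr gauss_exp; apply/funext => g; congr gauss_exp; apply/funext => h; congr F.
by apply/funext => -[|i].
Qed.

(* Measurability of a function of a sequence, tested along every sequence of real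
   random variables, so that no sigma-algebra on [nat -> R] is needed. *)
Definition coord_measurable (F : (nat -> R) -> R) :=
  forall (d : measure_display) (T : measurableType d) (X : nat -> T -> R),
    (forall i, measurable_fun setT (X i)) ->
    measurable_fun setT (fun t => F (fun i => X i t)).

(** Realizes the iterated integral on one probability space with coordinates [X], so that
    monotonicity, linearity and dominated convergence become available. *)
Lemma gauss_exp_Rintegral (n : nat) : exists (d : measure_display)
    (T : measurableType d) (P : probability T R) (X : nat -> T -> R),
  (forall i, measurable_fun setT (X i)) /\
  forall F, coord_measurable F -> (exists M : R, forall g, `|F g| <= M) ->
    gauss_exp n F = \int[P]_t F (fun i => X i t).
Proof.
elim: n => [|n [d [T [P [X [mX IH]]]]]].
  (* Any probability space serves here: [gauss_exp 0] evaluates at the zero sequence. *)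
  exists _, _, gamma, (fun _ _ => 0); split => // F _ _ /=.
  by rewrite Rintegral_probability_cst.
pose X' i (z : measurableTypeR R * T) := if i is j.+1 then X j z.2 else z.1.
have mX' i : measurable_fun setT (X' i).
  case: i => [|i]; first exact: measurable_fst.
  exact: (measurableT_comp (mX i) measurable_snd).
exists _, (measurableTypeR R * T)%type, (gamma \x P)%E, X'; split => // F mF [M FM].
have bF : bounded_measurable (fun z => F (fun i => X' i z)).
  by split; [exact: mF|exists M].
rewrite (Rintegral_prod gamma P bF) -Rintegral_normal_prob; last first.
  exact: (bounded_measurable_Rintegral2 gamma P bF).
apply: eq_Rintegral => x _; congr (_ * _); apply: etrans (IH _ _ _) _.
- move=> d' T' Y mY; apply: (mF _ _ (fun i t => if i == 0%N then x else Y i.-1 t)).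
  by case=> [|i] //=.
- by exists M.
- by apply: eq_Rintegral => t _; congr F; apply/funext => -[|i].
Qed.

Lemma gauss_exp_cst (n : nat) (c : R) : gauss_exp n (fun _ => c) = c.
Proof.
have [d [T [P [X [_ E]]]]] := gauss_exp_Rintegral n.
have mc : coord_measurable (fun _ => c) by move=> d' T' Y _; exact: measurable_cst.
by apply: etrans (E _ mc _) _; [exists (`|c|)|exact: Rintegral_probability_cst].
Qed.

Lemma gauss_exp_le (n : nat) (F G : (nat -> R) -> R) :
  coord_measurable F -> (exists M : R, forall g, `|F g| <= M) ->
  coord_measurable G -> (exists M : R, forall g, `|G g| <= M) ->
  (forall g, F g <= G g) -> gauss_exp n F <= gauss_exp n G.
Proof.
move=> mF [M FM] mG [M' GM] FG; have [d [T [P [X [mX E]]]]] := gauss_exp_Rintegral n.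
rewrite !E//; [|by exists M'|by exists M].
apply: le_Rintegral => //; apply: bounded_measurable_integrable.
- by split; [exact: mF|exists M].
- by split; [exact: mG|exists M'].
Qed.

Section linear_combination.
Variables (I : Type) (c : I -> R) (F : I -> (nat -> R) -> R).
Hypothesis mF : forall i, coord_measurable (F i).
Hypothesis bF : forall i, exists M : R, forall g, `|F i g| <= M.

Lemma coord_measurable_sum (r : seq I) :
  coord_measurable (fun g => \sum_(i <- r) c i * F i g).
Proof.
move=> d T Y mY; apply: measurable_sum => i; apply: measurable_funM => //.
exact: mF.
Qed.

Lemma bounded_lincomb (r : seq I) :
  exists M : R, forall g, `|\sum_(i <- r) c i * F i g| <= M.
Proof.
elim: r => [|i s [M HM]]; first by exists 0 => g; rewrite big_nil normr0.
have [M' HM'] := bF i; exists (`|c i| * M' + M) => g.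
rewrite big_cons; apply: le_trans (ler_normD _ _) _; apply: lerD => //.
by rewrite normrM ler_wpM2l.
Qed.

Lemma gauss_exp_sum (n : nat) (r : seq I) :
  gauss_exp n (fun g => \sum_(i <- r) c i * F i g) =
  \sum_(i <- r) c i * gauss_exp n (F i).
Proof.
have [d [T [P [X [mX E]]]]] := gauss_exp_Rintegral n.
have bS r' : bounded_measurable (fun t => \sum_(i <- r') c i * F i (fun j => X j t)).
  split; first exact: coord_measurable_sum.
  by have [M HM] := bounded_lincomb r'; exists M.
rewrite E; [|exact: coord_measurable_sum|exact: bounded_lincomb].
elim: r => [|i r IH].
  by rewrite big_nil; under eq_Rintegral do rewrite big_nil;
    rewrite Rintegral_probability_cst.
rewrite big_cons -IH E//; under eq_Rintegral do rewrite big_cons.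
have iF : P.-integrable setT (EFin \o (fun t => F i (fun j => X j t))).
  apply: bounded_measurable_integrable; split; first exact: mF.
  by have [M HM] := bF i; exists M.
rewrite RintegralD ?RintegralZl//; last exact: bounded_measurable_integrable.
apply: bounded_measurable_integrable.
by have := bS [:: i]; under eq_fun do rewrite big_seq1.
Qed.

Lemma gauss_exp_sum_le (n : nat) (r : seq I) (B : R) :
  (forall g, \sum_(i <- r) c i * F i g <= B) ->
  \sum_(i <- r) c i * gauss_exp n (F i) <= B.
Proof.
move=> FB; rewrite -gauss_exp_sum -[leRHS](gauss_exp_cst n).
apply: gauss_exp_le => //.
- exact: coord_measurable_sum.
- exact: bounded_lincomb.
- by exists `|B| => _.
Qed.

End linear_combination.

End gauss_exp_measure.

(** * Rounding correlation *)

Section rounding_correlation.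
Context {R : realType}.
Local Notation gamma := (normal_prob 0 1 : probability (measurableTypeR R) R).

(** The joint law of two Gaussian projections is fixed by the Gram matrix: the relations of
    [gauss_exp_linear2] force [p = 1], [q = dotp u v] and the value of [r]. *)
Lemma gauss_exp_unit2 (N : nat) (u v : 'I_N -> R) (H : R * R -> R) :
  unit_sphere u -> unit_sphere v -> bounded_measurable H ->
  gauss_exp N (fun g => H (\sum_(j < N) g j * u j, \sum_(j < N) g j * v j)) =
  \int[gamma]_x \int[gamma]_y
    H (x, dotp u v * x + Num.sqrt (1 - dotp u v ^+ 2) * y).
Proof.
move=> /unit_sphere_dotp u1 /unit_sphere_dotp v1 bH.
pose ext (w : 'I_N -> R) i := oapp w 0 (insub i).
have extE w (j : 'I_N) : ext w j = w j by rewrite /ext valK.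
have [p [q [r [[p0 r0] pE pqE qrE E]]]] := gauss_exp_linear2 N (ext u) (ext v).
have {pE}p1 : p = 1.
  apply/eqP; rewrite -sqrp_eq1// pE -u1 /dotp; apply/eqP.
  by apply: eq_bigr => j _; rewrite extE expr2.
have {pqE}qE : q = dotp u v.
  by rewrite -[LHS]mul1r -p1 pqE; apply: eq_bigr => j _; rewrite !extE.
have {qrE}rE : r = Num.sqrt (1 - dotp u v ^+ 2).
  rewrite -qE -v1 (_ : dotp v v = q ^+ 2 + r ^+ 2).
    by rewrite addrAC subrr add0r sqrtr_sqr ger0_norm.
  by rewrite qrE; apply: eq_bigr => j _; rewrite extE expr2.
have := E _ bH; rewrite p1 qE rE => E'.
transitivity (gauss_exp N (fun g =>
    H (\sum_(i < N) g i * ext u i, \sum_(i < N) g i * ext v i))).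
  congr gauss_exp; apply/funext => g; congr (H (_, _));
  by apply: eq_bigr => j _; rewrite extE.
by rewrite E'; apply: eq_Rintegral => x _; apply: eq_Rintegral => y _; rewrite mul1r.
Qed.

Definition vec3 (a b c : R) : 'I_3 -> R := fun i => [:: a; b; c]`_i.

(** Each pair holds the products of one row of the Gaussian matrix with the two vectors. Grouping by
    rows allows one row to be integrated at a time. *)
Definition rounding3 (z : (R * R) * (R * R) * (R * R)) : R :=
  dotp (normalize (vec3 z.1.1.1 z.1.2.1 z.2.1))
       (normalize (vec3 z.1.1.2 z.1.2.2 z.2.2)).

Lemma bounded_measurable_rounding3 : bounded_measurable rounding3.
Proof.
split; last by exists 1 => z; exact: ler_norm_dotp_normalize.
have m1 : measurable_fun setT (fun z : (R * R) * (R * R) * (R * R) => z.1.1).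
  by apply: measurableT_comp.
have m2 : measurable_fun setT (fun z : (R * R) * (R * R) * (R * R) => z.1.2).
  by apply: measurableT_comp.
apply: measurable_dotp_normalize => -[[|[|[|//]]] i3]; rewrite /vec3/=;
  by apply: measurableT_comp.
Qed.

Definition rounding_corr (q r : R) : R :=
  \int[gamma]_x1 \int[gamma]_y1 \int[gamma]_x2 \int[gamma]_y2
  \int[gamma]_x3 \int[gamma]_y3
    rounding3 ((x1, q * x1 + r * y1), (x2, q * x2 + r * y2), (x3, q * x3 + r * y3)).

Lemma bounded_measurable_pair_affine {d : measure_display} {T : measurableType d}
    (P : probability T R) (q r : R) (H : T * (R * R) -> R) : bounded_measurable H ->
  bounded_measurable
    (fun t => \int[gamma]_x \int[gamma]_y H (t, (x, q * x + r * y))).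
Proof.
move=> bH.
pose f (z : T * R * R) := H (z.1.1, (z.1.2, q * z.1.2 + r * z.2)).
have bf : bounded_measurable f.
  have m2 : measurable_fun setT (fun z : T * R * R => z.1.2) by apply: measurableT_comp.
  apply: (bounded_measurable_comp bH); apply: measurable_fun_pair.
    by apply: measurableT_comp.
  apply: measurable_fun_pair => //.
  by apply: measurable_funD; exact: measurable_funM.
have bf1 := bounded_measurable_Rintegral2 (P \x gamma)%E gamma bf.
exact: (bounded_measurable_Rintegral2 P gamma bf1).
Qed.

(** The rows are independent, and [gauss_exp_unit2] replaces each of them by a correlated pair,
    starting from the innermost integral. *)
Lemma gauss_mx_exp_rounding_corr (N : nat) (u v : 'I_N -> R) :
  unit_sphere u -> unit_sphere v ->
  gauss_mx_exp (fun Z : 'M[R]_(3, N) =>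
    dotp (normalize (mxvec_mul Z u)) (normalize (mxvec_mul Z v))) =
  rounding_corr (dotp u v) (Num.sqrt (1 - dotp u v ^+ 2)).
Proof.
move=> u1 v1; set q := dotp u v; set r := Num.sqrt _.
pose s (g : nat -> R) := (\sum_(j < N) g j * u j, \sum_(j < N) g j * v j).
(* In the row-major numbering the three rows are consecutive blocks of length [N]. *)
rewrite /gauss_mx_exp (_ : 3 * N = N + (N + N))%N; last by rewrite !mulSn mul0n addn0.
rewrite gauss_exp_cat.
transitivity (gauss_exp N (fun g1 => gauss_exp N (fun g2 => gauss_exp N (fun g3 =>
    rounding3 (s g1, s g2, s g3))))).
  congr gauss_exp; apply/funext => g1; rewrite gauss_exp_cat.
  congr gauss_exp; apply/funext => g2; congr gauss_exp; apply/funext => g3.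
  rewrite /rounding3/=; congr (dotp (normalize _) (normalize _));
    apply/funext => -[[|[|[|//]]] i3]; rewrite /mxvec_mul /vec3/=;
    apply: eq_bigr => j _; rewrite mxE/=; have jN := ltn_ord j; congr (_ * _).
  - by rewrite mul0n add0n jN.
  - by rewrite mul1n ltnNge leq_addr/= addKn jN.
  - by rewrite mul2n -addnn -addnA ltnNge leq_addr/= addKn ltnNge leq_addr/= addKn.
  - by rewrite mul0n add0n jN.
  - by rewrite mul1n ltnNge leq_addr/= addKn jN.
  - by rewrite mul2n -addnn -addnA ltnNge leq_addr/= addKn ltnNge leq_addr/= addKn.
have b3 := bounded_measurable_rounding3.
pose H2 (z : (R * R) * (R * R)) :=
  \int[gamma]_x \int[gamma]_y rounding3 (z, (x, q * x + r * y)).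
have b2 : bounded_measurable H2.
  exact: (bounded_measurable_pair_affine ((gamma \x gamma) \x (gamma \x gamma))%E).
pose H1 (z : R * R) := \int[gamma]_x \int[gamma]_y H2 (z, (x, q * x + r * y)).
have b1 : bounded_measurable H1.
  exact: (bounded_measurable_pair_affine (gamma \x gamma)%E).
transitivity (gauss_exp N (fun g1 => H1 (s g1))); last exact: (gauss_exp_unit2 u1 v1 b1).
congr gauss_exp; apply/funext => g1.
transitivity (gauss_exp N (fun g2 => H2 (s g1, s g2))).
  congr gauss_exp; apply/funext => g2.
  apply: (gauss_exp_unit2 (H := fun z => rounding3 (s g1, s g2, z)) u1 v1).
  by apply: (bounded_measurable_comp b3); exact: pair1_measurable.
apply: (gauss_exp_unit2 (H := fun z => H2 (s g1, z)) u1 v1).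
by apply: (bounded_measurable_comp b2); exact: pair1_measurable.
Qed.

Lemma Fstar_rounding_corr (rho : R) : -1 <= rho <= 1 ->
  Fstar 3 rho = rounding_corr rho (Num.sqrt (1 - rho ^+ 2)).
Proof.
move=> /andP[r1 r2].
have r0 : 0 <= 1 - rho ^+ 2 by nra.
rewrite /Fstar gauss_mx_exp_rounding_corr.
- by rewrite /dotp !big_ord_recl !big_ord0/= mul0r !addr0 mul1r.
- by apply/unit_sphere_dotp; rewrite /dotp !big_ord_recl !big_ord0/= mul0r !addr0 mul1r.
- apply/unit_sphere_dotp; rewrite /dotp !big_ord_recl !big_ord0/= addr0.
  by rewrite -!expr2 sqr_sqrtr// addrC subrK.
Qed.

Lemma gauss_mx_exp_rounding (N : nat) (u v : 'I_N -> R) :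
  unit_sphere u -> unit_sphere v ->
  gauss_mx_exp (fun Z : 'M[R]_(3, N) =>
    dotp (normalize (mxvec_mul Z u)) (normalize (mxvec_mul Z v))) =
  Fstar 3 (dotp u v).
Proof.
move=> u1 v1; rewrite gauss_mx_exp_rounding_corr// Fstar_rounding_corr//.
rewrite -ler_norml; apply: ler_norm_dotp.
  by have /unit_sphere_dotp -> := u1.
by have /unit_sphere_dotp -> := v1.
Qed.

End rounding_correlation.

(** * Continuity and oddness of [Fstar 3] *)

Section Fstar_theory.
Context {R : realType}.
Local Notation gamma := (normal_prob 0 1 : probability (measurableTypeR R) R).

(** Dominated convergence along sequences, with the constant [M] as dominating function. *)
Lemma continuous_Rintegral {d : measure_display} {T : measurableType d}
    (P : probability T R) (f : R -> T -> R) (a M : R) :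
  (forall x, measurable_fun setT (f x)) -> (forall x t, `|f x t| <= M) ->
  {ae P, forall t, {for a, continuous (f ^~ t)}} ->
  {for a, continuous (fun x => \int[P]_t f x t)}.
Proof.
move=> mf fM cf.
have If x : P.-integrable setT (EFin \o f x).
  by apply: bounded_measurable_integrable; split => //; exists M.
apply/(@cvg_nbhsP _ R^o) => w wa; apply: fine_cvg.
rewrite fineK; last exact: integrable_fin_num (If a).
have [] := @dominated_convergence _ _ _ P setT measurableT
    (fun n t => (f (w n) t)%:E) (fun t => (f a t)%:E) (EFin \o cst M) _ _ _ _ _.
- by move=> n; apply/measurable_EFinP.
- exact/measurable_EFinP.
- case: cf => A [mA A0 sA]; exists A; split => // t /= ht; apply: sA => /= h; apply: ht.
  move=> _; apply: cvg_EFin; first exact: nearW.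
  by move: h => /(@cvg_nbhsP _ R^o); exact.
- by apply: bounded_measurable_integrable; split => //; exists `|M|.
- by apply: nearW => t n _; rewrite lee_fin.
by [].
Qed.

Lemma continuous_at_sum (I : Type) (r : seq I) (f : I -> R -> R) (a : R) :
  (forall i, {for a, continuous (f i)}) ->
  {for a, continuous (fun s => \sum_(i <- r) f i s)}.
Proof.
move=> cf; elim: r => [|i r IH].
  rewrite (_ : (fun s => _) = cst 0); first exact: cvg_cst.
  by apply/funext => s; rewrite big_nil.
rewrite (_ : (fun s => _) = (fun s => f i s + \sum_(j <- r) f j s)); last first.
  by apply/funext => s; rewrite big_cons.
by apply: (@cvgD _ R^o); [exact: cf|exact: IH].
Qed.

Lemma continuous_dotp_normalize (k : nat) (x : 'I_k -> R) (b : R -> 'I_k -> R)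
    (a : R) : (forall i, {for a, continuous (fun s => b s i)}) ->
  dotp (b a) (b a) != 0 ->
  {for a, continuous (fun s => dotp (normalize x) (normalize (b s)))}.
Proof.
move=> cb b0.
have cdot : {for a, continuous (fun s => dotp (b s) (b s))}.
  by apply: continuous_at_sum => i; apply: cvgM; exact: cb.
apply: continuous_at_sum => i; apply: cvgM; first exact: cvg_cst.
apply: cvgM; first exact: cb.
apply: cvgV; first by rewrite sqrtr_eq0 -ltNge lt_neqAle eq_sym b0 dotp_ge0.
apply: continuous_cvg; last exact: cdot.
exact: sqrt_continuous.
Qed.

Lemma coord_measurable_rounding (k N : nat) (u v : 'I_N -> R) :
  coord_measurable (fun g : nat -> R =>
    let Z := \matrix_(i < k, j < N) g (i * N + j)%N in
    dotp (normalize (mxvec_mul Z u)) (normalize (mxvec_mul Z v))).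
Proof.
move=> d T X mX; apply: measurable_dotp_normalize => i; apply: measurable_sum => j;
  by under eq_fun do rewrite mxE; exact: measurable_funM.
Qed.

Lemma Fstar_le1 (k : nat) (rho : R) : `|Fstar k rho| <= 1.
Proof.
rewrite /Fstar /gauss_mx_exp.
have [d [T [P [X [mX E]]]]] := @gauss_exp_Rintegral R (k * 2).
rewrite E; last by exists 1 => g; exact: ler_norm_dotp_normalize.
  apply: Rintegral_probability_le; first exact: coord_measurable_rounding.
  by move=> t; exact: ler_norm_dotp_normalize.
exact: coord_measurable_rounding.
Qed.

Lemma normal_prob_set1 (x : R) : gamma [set x] = 0%E.
Proof.
have /null_content_dominatesP := normal_prob_dominates (0 : R) 1.
by apply; [exact: measurable_set1|exact: lebesgue_measure_set1].
Qed.

Lemma eqr0_indic (x : R) : (x == 0)%:R = \1_[set (0 : R)] x :> R.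
Proof. by rewrite indicE; congr (nat_of_bool _)%:R; apply/eqP/idP; rewrite inE. Qed.

Lemma measurable_eqr0 : measurable_fun setT (fun x : R => (x == 0)%:R : R).
Proof.
rewrite (_ : (fun x => _) = \1_[set 0]); last by apply/funext => x; exact: eqr0_indic.
by apply: measurable_indic; exact: measurable_set1.
Qed.

(** The projection of a row on a unit vector is a standard Gaussian, which has no atom at zero. *)
Lemma gauss_exp_row_eq0 (N n : nat) (v : 'I_N -> R) : unit_sphere v ->
  gauss_exp (N + n) (fun g => (\sum_(j < N) g j * v j == 0)%:R) = 0 :> R.
Proof.
move=> v1; rewrite gauss_exp_cat.
transitivity (gauss_exp N (fun g => (\sum_(j < N) g j * v j == 0)%:R : R)).
  congr gauss_exp; apply/funext => g.
  transitivity (gauss_exp n (fun _ => (\sum_(j < N) g j * v j == 0)%:R : R)).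
    congr gauss_exp; apply/funext => h; congr (_ == _)%:R.
    by apply: eq_bigr => j _; rewrite ltn_ord.
  exact: gauss_exp_cst.
rewrite (gauss_exp_unit2 (H := fun z => (z.1 == 0)%:R) v1 v1); last first.
  split; first by apply: (measurableT_comp measurable_eqr0); exact: measurable_fst.
  by exists 1 => z; case: (_ == _); rewrite ?normr1 ?normr0.
under eq_Rintegral do rewrite /= Rintegral_probability_cst.
transitivity (fine (\int[gamma]_x (\1_[set (0 : R)] x)%:E)%E).
  by congr fine; apply: eq_integral => x _; rewrite -eqr0_indic.
rewrite integral_indic// setIT.
by rewrite -[RHS]/(fine 0%E) -(normal_prob_set1 0).
Qed.

Lemma continuous_Fstar3 (rho : R) : -1 <= rho <= 1 ->
  {for rho, continuous (Fstar 3)}.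
Proof.
move=> /andP[r1 r2].
have [d [T [P [X [mX E]]]]] := @gauss_exp_Rintegral R (3 * 2).
pose u : 'I_2 -> R := fun i => if i == ord0 then 1 else 0.
pose v (s : R) : 'I_2 -> R := fun i => if i == ord0 then s else Num.sqrt (1 - s ^+ 2).
pose Z t := \matrix_(i < 3, j < 2) X (i * 2 + j)%N t.
pose f s t := dotp (normalize (mxvec_mul (Z t) u)) (normalize (mxvec_mul (Z t) (v s))).
have FE s : Fstar 3 s = \int[P]_t f s t.
  rewrite /Fstar /gauss_mx_exp E//; first exact: coord_measurable_rounding.
  by exists 1 => g; exact: ler_norm_dotp_normalize.
rewrite (_ : Fstar 3 = fun s => \int[P]_t f s t); last by apply/funext.
apply: (continuous_Rintegral (M := 1)).
- move=> s; exact: (@coord_measurable_rounding 3 _ u (v s) _ _ _ mX).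
- by move=> s t; exact: ler_norm_dotp_normalize.
have v1 : unit_sphere (v rho).
  apply/unit_sphere_dotp; rewrite /dotp !big_ord_recl !big_ord0/= addr0 /v/=.
  by rewrite -!expr2 sqr_sqrtr ?subrKC//; nra.
(* The exceptional set is where the first row of [Z] is orthogonal to [v rho]; outside it
   [Z (v rho)] is nonzero and normalization is continuous there. *)
pose b t := \sum_(j < 2) X j t * v rho j.
have mb : measurable_fun setT b by apply: measurable_sum => j; exact: measurable_funM.
pose A := b @^-1` [set 0].
have mA : measurable A by rewrite -[A]setTI; exact: mb.
have mF : coord_measurable (fun g => (\sum_(j < 2) g j * v rho j == 0)%:R : R).
  move=> d' T' Y mY.
  apply: (measurableT_comp measurable_eqr0); apply: measurable_sum => j.
  exact: measurable_funM.
exists A; split => //.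
  (* The [4] counts the entries of the other two rows. *)
  have := gauss_exp_row_eq0 4 v1; rewrite (E _ mF); last first.
    by exists 1 => g; case: (_ == _); rewrite ?normr1 ?normr0.
  rewrite /Rintegral (eq_integral (fun t => (\1_A t)%:E)); last first.
    move=> t _; congr EFin; rewrite indicE; congr (nat_of_bool _)%:R.
    by apply/eqP/idP; rewrite inE.
  rewrite integral_indic// setIT => PA0; rewrite -[LHS]fineK ?PA0//.
  exact: fin_num_measure.
move=> t /= ht; apply: contrapT => bt0; apply: ht.
apply: continuous_dotp_normalize => [i|].
  apply: continuous_at_sum => j; apply: cvgM; first exact: cvg_cst.
  rewrite /v; case: (j == ord0); first exact: cvg_id.
  (* [Num.sqrt] vanishes on negative numbers and is continuous on the whole line, so the endpoints
     [rho = 1] and [rho = -1] need no separate treatment. *)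
  apply: continuous_cvg; first exact: sqrt_continuous.
  apply: cvgB; first exact: cvg_cst.
  exact: exprn_continuous.
apply/eqP => /eqP; rewrite psumr_eq0; last by move=> i _; rewrite -expr2 sqr_ge0.
move=> /allP /(_ ord0); rewrite mem_index_enum => /(_ isT) /=.
rewrite mulf_eq0 orbb => /eqP e; apply: bt0; rewrite /A/= -e.
by apply: eq_bigr => j _; rewrite mxE.
Qed.

(** Negating [v] negates its rounding. The vector [vN] differs in its second coordinate from the one
    in the definition of [Fstar] at [- rho], but by [gauss_mx_exp_rounding] only the inner product
    with [u] matters. *)
Lemma Fstar3_opp (rho : R) : -1 <= rho <= 1 -> Fstar 3 (- rho) = - Fstar 3 rho.
Proof.
move=> /andP[r1 r2].
pose u : 'I_2 -> R := fun i => if i == ord0 then 1 else 0.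
pose v : 'I_2 -> R := fun i => if i == ord0 then rho else Num.sqrt (1 - rho ^+ 2).
pose vN : 'I_2 -> R := fun i => - v i.
have u1 : unit_sphere u.
  by apply/unit_sphere_dotp; rewrite /dotp !big_ord_recl !big_ord0/= mul0r !addr0 mul1r.
have vN1 : unit_sphere vN.
  apply/unit_sphere_dotp; rewrite /dotp !big_ord_recl !big_ord0/= addr0 /vN /v/=.
  by rewrite -!expr2 !sqrrN sqr_sqrtr ?subrKC//; nra.
have uvN : dotp u vN = - rho.
  by rewrite /dotp !big_ord_recl !big_ord0/= mul0r !addr0 mul1r.
rewrite -uvN -gauss_mx_exp_rounding//.
have := @gauss_exp_sum R unit (fun _ => -1) (fun _ g =>
    let Z := \matrix_(i < 3, j < 2) g (i * 2 + j)%N in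
    dotp (normalize (mxvec_mul Z u)) (normalize (mxvec_mul Z v))) _ _ (3 * 2) [:: tt].
rewrite big_seq1 mulN1r => <-.
- rewrite /gauss_mx_exp; congr gauss_exp; apply/funext => g.
  rewrite big_seq1 mulN1r /=; set Z := \matrix_(_, _) _.
  have -> : mxvec_mul Z vN = fun i => - mxvec_mul Z v i.
    by apply/funext => i; rewrite /mxvec_mul -sumrN; apply: eq_bigr => j _; rewrite mulrN.
  rewrite {1}/dotp -sumrN; apply: eq_bigr => i _; rewrite -mulrN; congr (_ * _).
  rewrite /normalize mulNr; congr (- (_ / Num.sqrt _)).
  by apply: eq_bigr => j _; rewrite mulrNN.
- by move=> _; exact: coord_measurable_rounding.
- by move=> _; exists 1 => g; exact: ler_norm_dotp_normalize.
Qed.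

End Fstar_theory.

(** * Noisy hypercube *)

Section noisy_cube.
Context {R : realType}.
Variable d : nat.
Local Notation cube := {ffun 'I_d -> bool}.
Local Notation sg b := ((-1) ^+ (nat_of_bool b) : R).

(** The conditional law of [y] given [x]; the factor for the uniform choice of [x] enters with
    [cube_weight]. *)
Definition noise (rho : R) (x y : cube) : R :=
  \prod_(i < d) ((1 + rho * (sg (x i) * sg (y i))) / 2).

Lemma noise_ge0 rho x y : -1 <= rho <= 1 -> 0 <= noise rho x y.
Proof.
move=> /andP[r1 r2]; apply: prodr_ge0 => i _; rewrite divr_ge0//.
by case: (x i); case: (y i); rewrite ?expr0 ?expr1; lra.
Qed.

Lemma noise_diag rho x : noise rho x x = ((1 + rho) / 2) ^+ d.
Proof.
rewrite /noise; under eq_bigr do rewrite -expr2 sqrr_sign mulr1.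
by rewrite prodr_const card_ord.
Qed.

(** Given [x], the coordinates of [y] are independent, so expectations of products factor. All
    moments below are instances. *)
Lemma sum_noise_prod rho x (phi : 'I_d -> bool -> R) :
  \sum_y noise rho x y * \prod_(i < d) phi i (y i) =
  \prod_(i < d) ((1 + rho * sg (x i)) / 2 * phi i false +
                 (1 - rho * sg (x i)) / 2 * phi i true).
Proof.
transitivity (\prod_(i < d) \sum_(b : bool)
    ((1 + rho * (sg (x i) * sg b)) / 2 * phi i b)).
  by rewrite bigA_distr_bigA/=; apply: eq_bigr => y _; rewrite -big_split.
apply: eq_bigr => i _; rewrite big_bool/= addrC expr0 expr1; congr (_ + _).
  by rewrite mulr1.
by rewrite mulrN1 mulrN.
Qed.

Lemma sum_noise rho x : \sum_y noise rho x y = 1.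
Proof.
transitivity (\sum_y noise rho x y * \prod_(i < d) 1).
  by apply: eq_bigr => y _; rewrite big1 ?mulr1.
rewrite (sum_noise_prod rho x (fun _ _ => 1)) big1// => i _; lra.
Qed.

Lemma sum_noise_sign rho x j :
  \sum_y noise rho x y * (sg (x j) * sg (y j)) = rho.
Proof.
pose phi i b : R := if i == j then sg (x i) * sg b else 1.
transitivity (\sum_y noise rho x y * \prod_(i < d) phi i (y i)).
  apply: eq_bigr => y _; congr (_ * _).
  rewrite (bigD1 j)//= big1 ?mulr1; first by rewrite /phi eqxx.
  by move=> i /negPf ij; rewrite /phi ij.
rewrite sum_noise_prod (bigD1 j)//= big1 ?mulr1.
  by rewrite /phi eqxx; case: (x j); rewrite ?expr0 ?expr1; lra.
by move=> i /negPf ij; rewrite /phi ij; lra.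
Qed.

(** Distinct coordinates are independent and centred, so their covariance vanishes; for [j = k] the
    variance is [1 - rho ^+ 2]. *)
Lemma sum_noise_cov rho x j k : -1 <= rho <= 1 ->
  \sum_y noise rho x y *
     ((sg (x j) * sg (y j) - rho) * (sg (x k) * sg (y k) - rho)) <=
  (j == k)%:R.
Proof.
move=> /andP[r1 r2]; have [<-|jk] := eqVneq j k.
  have -> : \sum_y noise rho x y *
     ((sg (x j) * sg (y j) - rho) * (sg (x j) * sg (y j) - rho)) =
     \sum_y (noise rho x y * (1 + rho ^+ 2) -
      (2 * rho) * (noise rho x y * (sg (x j) * sg (y j)))).
    apply: eq_bigr => y _.
    by case: (x j); case: (y j); rewrite ?expr0 ?expr1; ring.
  rewrite sumrB -mulr_suml -mulr_sumr sum_noise sum_noise_sign mulr1n.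
  by have := sqr_ge0 rho; rewrite expr2; lra.
pose phi i b : R := if (i == j) || (i == k) then sg (x i) * sg b - rho else 1.
have -> : \sum_y noise rho x y *
    ((sg (x j) * sg (y j) - rho) * (sg (x k) * sg (y k) - rho)) =
    \sum_y noise rho x y * \prod_(i < d) phi i (y i).
  apply: eq_bigr => y _; congr (_ * _).
  rewrite (bigD1 j)//= (bigD1 k)/=; last by rewrite eq_sym.
  rewrite big1 ?mulr1; first by rewrite /phi !eqxx orbT.
  by move=> i /andP[/negPf ij /negPf ik]; rewrite /phi ij ik.
rewrite sum_noise_prod (bigD1 j)//= [X in X * _](_ : _ = 0) ?mul0r//.
by rewrite /phi eqxx/=; case: (x j); rewrite ?expr0 ?expr1; lra.
Qed.

Definition cube_corr (x y : cube) : R := (\sum_(i < d) sg (x i) * sg (y i)) / d%:R.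

Lemma sum_noise_corr rho x : (0 < d)%N ->
  \sum_y noise rho x y * cube_corr x y = rho.
Proof.
move=> d0; rewrite /cube_corr; under eq_bigr do rewrite mulrA mulr_sumr.
rewrite -mulr_suml exchange_big/=.
under eq_bigr do rewrite sum_noise_sign.
by rewrite sumr_const card_ord -[rho *+ d]mulr_natr mulfK// pnatr_eq0 -lt0n.
Qed.

(** The variance of an average of [d] uncorrelated signs, each of variance at most one. *)
Lemma noise_concentration rho x : (0 < d)%N -> -1 <= rho <= 1 ->
  \sum_y noise rho x y * (cube_corr x y - rho) ^+ 2 <= d%:R^-1.
Proof.
move=> d0 r1.
have dn : d%:R != 0 :> R by rewrite pnatr_eq0 -lt0n.
have cE y : cube_corr x y - rho = (\sum_(i < d) (sg (x i) * sg (y i) - rho)) / d%:R.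
  rewrite sumrB sumr_const card_ord -[rho *+ d]mulr_natr mulrBl mulfK//.
have -> : \sum_y noise rho x y * (cube_corr x y - rho) ^+ 2 =
    (\sum_(j < d) \sum_(k < d) \sum_y noise rho x y *
     ((sg (x j) * sg (y j) - rho) * (sg (x k) * sg (y k) - rho))) / d%:R ^+ 2.
  under eq_bigr do rewrite cE expr_div_n mulrA.
  rewrite -mulr_suml; congr (_ / _).
  under [RHS]eq_bigr do rewrite exchange_big/=.
  rewrite [RHS]exchange_big/=; apply: eq_bigr => y _.
  rewrite expr2 mulr_suml mulr_sumr; apply: eq_bigr => j _.
  by rewrite !mulr_sumr.
apply: (@le_trans _ _ ((\sum_(j < d) \sum_(k < d) (j == k)%:R) / d%:R ^+ 2)).
  rewrite ler_wpM2r ?invr_ge0 ?sqr_ge0//.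
  by apply: ler_sum => j _; apply: ler_sum => k _; exact: sum_noise_cov.
rewrite (eq_bigr (fun=> 1)); last first.
  move=> j _; rewrite (bigD1 j)//= eqxx big1 ?addr0// => k.
  by rewrite eq_sym => /negPf ->.
by rewrite sumr_const card_ord expr2 invfM mulrA divff// mul1r.
Qed.

Definition character (S : {set 'I_d}) (x : cube) : R := \prod_(i in S) sg (x i).

(** Expand the product defining [noise]: [S] is the set of factors from which the term containing
    [rho] is taken. *)
Lemma noise_fourier rho x y :
  noise rho x y = 2 ^- d *
    \sum_(S : {set 'I_d}) rho ^+ #|S| * (character S x * character S y).
Proof.
rewrite /noise big_split/= prodr_const card_ord exprVn mulrC; congr (_ * _).
under eq_bigr do rewrite addrC.
rewrite bigA_distr; apply: eq_bigr => S _.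
rewrite -big_mkcond/= /character -big_split/= -prodr_const -big_split/=.
by [].
Qed.

Lemma noise_form rho (h : cube -> R) :
  \sum_x \sum_y noise rho x y * (h x * h y) =
  2 ^- d * \sum_(S : {set 'I_d}) rho ^+ #|S| * (\sum_x h x * character S x) ^+ 2.
Proof.
under eq_bigr do under eq_bigr do rewrite noise_fourier -mulrA mulr_suml.
under eq_bigr do rewrite -mulr_sumr exchange_big/=.
rewrite -mulr_sumr exchange_big/=; congr (_ * _); apply: eq_bigr => S _.
rewrite expr2 mulr_suml mulr_sumr; apply: eq_bigr => x _.
rewrite mulr_sumr mulr_sumr; apply: eq_bigr => y _; ring.
Qed.

Lemma noise1 x y : noise 1 x y = (x == y)%:R.
Proof.
have [<-|xy] := eqVneq x y.
  by rewrite noise_diag (_ : (1 + 1) / 2 = 1 :> R) ?expr1n//; lra.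
have [i xi] : exists i, x i != y i.
  by apply/existsP; apply: contraNT xy => /existsPn h; apply/eqP/ffunP => i;
    have /negPn/eqP := h i.
rewrite /noise (bigD1 i)//= [X in X * _](_ : _ = 0) ?mul0r//.
by move: xi; case: (x i); case: (y i) => //= _; rewrite ?expr0 ?expr1; lra.
Qed.

(* The smallest eigenvalue of the noise operator at [rho <= 0] is [rho] itself,
   since the eigenvalues are the powers of [rho]; Parseval is the case [rho = 1]. *)
Lemma noise_form_ge rho (h : cube -> R) : -1 <= rho <= 0 ->
  rho * \sum_x h x ^+ 2 <= \sum_x \sum_y noise rho x y * (h x * h y).
Proof.
move=> /andP[r1 r0].
have -> : \sum_x h x ^+ 2 = \sum_x \sum_y noise 1 x y * (h x * h y).
  apply: eq_bigr => x _; rewrite (bigD1 x)//= noise1 eqxx mul1r -expr2.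
  by rewrite big1 ?addr0// => y; rewrite noise1 eq_sym => /negPf ->; rewrite mul0r.
rewrite !noise_form mulrCA ler_wpM2l// ?invr_ge0 ?exprn_ge0//.
rewrite mulr_sumr; apply: ler_sum => S _; rewrite expr1n mul1r ler_wpM2r ?sqr_ge0//.
(* The empty set has eigenvalue one. Otherwise [rho * rho ^+ n >= rho], because [rho] and
   [rho ^+ n - 1] are both nonpositive. *)
case: #|S| => [|n]; first by rewrite expr0; lra.
have : `|rho ^+ n| <= 1.
  by rewrite normrX exprn_ile1// ler0_norm//; lra.
rewrite exprS ler_norml => /andP[a b]; nra.
Qed.

End noisy_cube.

(** * Hypercube graph *)

Section cube_graph.
Context {R : realType}.
Variables (m : nat) (rho : R).
Hypothesis rho_le0 : -1 <= rho <= 0.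
Local Notation d := m.+1.
Local Notation cube := {ffun 'I_d -> bool}.
Local Notation N := #|{: cube}|.
Local Notation sg b := ((-1) ^+ (nat_of_bool b) : R).

Definition vert (u : 'I_N) : cube := enum_val u.

(* The probability that both endpoints of a noisy edge coincide. *)
Definition loop_mass : R := ((1 + rho) / 2) ^+ d.

Definition cube_weight (u v : 'I_N) : R :=
  if u == v then 0 else noise rho (vert u) (vert v) / (N%:R * (1 - loop_mass)).

(* The mean correlation of the edges that remain once the loops are deleted. *)
Definition loopless_corr : R := (rho - loop_mass) / (1 - loop_mass).

Let rho_le1 : -1 <= rho <= 1.
Proof. by case/andP: rho_le0 => r1 r0; lra. Qed.

Lemma loop_mass_ge0 : 0 <= loop_mass.
Proof. by apply: exprn_ge0; case/andP: rho_le0; lra. Qed.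

Lemma loop_mass_le : loop_mass <= 2^-1 ^+ d.
Proof. by rewrite lerXn2r ?nnegrE//; case/andP: rho_le0 => r1 r0; lra. Qed.

Lemma loop_mass_lt1 : loop_mass < 1.
Proof.
apply: le_lt_trans loop_mass_le _.
by apply: exprn_ilt1 => //; lra.
Qed.

Let card_gt0 : 0 < N%:R :> R.
Proof. by rewrite ltr0n card_ffun card_bool card_ord expn_gt0. Qed.

Lemma sum_vert (F : cube -> R) : \sum_(u < N) F (vert u) = \sum_x F x.
Proof. by rewrite [RHS](reindex _ (onW_bij _ (enum_val_bij _))). Qed.

(** All diagonal entries of [noise] equal [loop_mass], so deleting the loops subtracts that multiple
    of the trace. *)
Lemma edge_exp_cube (D : 'I_N -> 'I_N -> R) :
  edge_exp cube_weight D =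
  (\sum_(u < N) \sum_(v < N) noise rho (vert u) (vert v) * D u v -
   loop_mass * \sum_(u < N) D u u) / (N%:R * (1 - loop_mass)).
Proof.
rewrite mulr_sumr -sumrB mulr_suml; apply: eq_bigr => u _.
rewrite (bigD1 u)//= [in RHS](bigD1 u)//= /cube_weight eqxx mul0r add0r.
rewrite noise_diag addrAC subrr add0r mulr_suml; apply: eq_bigr => v.
by rewrite eq_sym => /negPf ->; rewrite mulrAC.
Qed.

Lemma noise_row (u : 'I_N) (F : cube -> R) :
  \sum_(v < N) noise rho (vert u) (vert v) * F (vert v) =
  \sum_y noise rho (vert u) y * F y.
Proof. exact: (sum_vert (fun y => noise rho (vert u) y * F y)). Qed.

Lemma noise_form_vert_ge (h : 'I_N -> R) :
  rho * \sum_(u < N) h u ^+ 2 <=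
  \sum_(u < N) \sum_(v < N) noise rho (vert u) (vert v) * (h u * h v).
Proof.
pose h' x := h (enum_rank x).
have hE u : h u = h' (vert u) by rewrite /h' enum_valK.
under eq_bigr do rewrite hE.
rewrite (sum_vert (fun x => h' x ^+ 2)).
apply: le_trans (noise_form_ge h' rho_le0) _.
rewrite -sum_vert le_eqVlt; apply/orP; left; apply/eqP; apply: eq_bigr => u _.
rewrite -(noise_row u (fun y => h' (vert u) * h' y)).
by apply: eq_bigr => v _; rewrite -!hE.
Qed.

Lemma weighted_graph_cube : weighted_graph cube_weight.
Proof.
have p1 := loop_mass_lt1; split=> [u v|].
  rewrite /cube_weight; case: ifP => // _; rewrite divr_ge0 ?noise_ge0//.
  by rewrite mulr_ge0 ?ler0n// subr_ge0 ltW.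
transitivity (edge_exp cube_weight (fun _ _ => 1)).
  by apply: eq_bigr => u _; apply: eq_bigr => v _; rewrite mulr1.
rewrite edge_exp_cube sumr_const card_ord.
rewrite (eq_bigr (fun=> 1)); last first.
  move=> u _; rewrite (noise_row u (fun=> 1)).
  by under eq_bigr do rewrite mulr1; exact: sum_noise.
rewrite sumr_const card_ord.
have -> : N%:R - loop_mass * N%:R = N%:R * (1 - loop_mass) :> R by ring.
by rewrite divff// mulf_neq0 ?gt_eqF// subr_gt0.
Qed.

Lemma no_self_loops_cube : no_self_loops cube_weight.
Proof. by move=> u; rewrite /cube_weight eqxx. Qed.

Lemma prod_val_cubeE (k : nat) (g : 'I_N -> 'I_k -> R) :
  prod_val cube_weight g =
  1 / 4 - 1 / 4 * edge_exp cube_weight (fun u v => dotp (g u) (g v)).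
Proof.
have [_ w1] := weighted_graph_cube.
transitivity (1 / 4 * (\sum_(u < N) \sum_(v < N) cube_weight u v) -
    1 / 4 * edge_exp cube_weight (fun u v => dotp (g u) (g v))); last first.
  by rewrite w1 mulr1.
rewrite -mulrBr /prod_val /edge_exp -sumrB mulr_sumr; apply: eq_bigr => u _.
rewrite -sumrB mulr_sumr.
by apply: eq_bigr => v _; ring.
Qed.

(** The eigenvalue bound is applied to each coordinate of [g]. Stating it for the unit ball also
    covers rounded vectors, which are zero when [Z] annihilates the vector being rounded. *)
Lemma prod_val_cube_le (k : nat) (g : 'I_N -> 'I_k -> R) :
  (forall u, dotp (g u) (g u) <= 1) ->
  prod_val cube_weight g <= 1 / 4 - 1 / 4 * loopless_corr.
Proof.
move=> g1; rewrite prod_val_cubeE.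
suff : loopless_corr <= edge_exp cube_weight (fun u v => dotp (g u) (g v)) by lra.
rewrite edge_exp_cube.
have p0 := loop_mass_ge0; have p1 := loop_mass_lt1.
have /andP[r1 r0] := rho_le0.
set S := \sum_(u < N) dotp (g u) (g u).
have SN : S <= N%:R.
  apply: (@le_trans _ _ (\sum_(u < N) 1)); first by apply: ler_sum => u _; exact: g1.
  by rewrite sumr_const card_ord.
have form : rho * S <= \sum_(u < N) \sum_(v < N)
    noise rho (vert u) (vert v) * dotp (g u) (g v).
  have -> : \sum_(u < N) \sum_(v < N) noise rho (vert u) (vert v) * dotp (g u) (g v) =
      \sum_(i < k) \sum_(u < N) \sum_(v < N)
        noise rho (vert u) (vert v) * (g u i * g v i).
    under eq_bigr do under eq_bigr do rewrite mulr_sumr.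
    by under eq_bigr do rewrite exchange_big/=; rewrite exchange_big.
  rewrite /S /dotp exchange_big/= mulr_sumr; apply: ler_sum => i _.
  have := noise_form_vert_ge (fun u => g u i).
  by congr (_ * _ <= _); apply: eq_bigr => u _; rewrite expr2.
rewrite /loopless_corr.
have -> : (rho - loop_mass) / (1 - loop_mass) =
    (rho - loop_mass) * N%:R / (N%:R * (1 - loop_mass)).
  by rewrite invfM mulrA mulfK// gt_eqF.
apply: ler_wpM2r.
  by rewrite invr_ge0 mulr_ge0// subr_ge0 ltW.
(* The factor [rho - loop_mass] is nonpositive, so the inequality [SN] reverses. *)
have rS : (rho - loop_mass) * N%:R <= (rho - loop_mass) * S.
  by rewrite ler_wnM2l//; lra.
by apply: le_trans rS _; rewrite mulrBl lerB.
Qed.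

(** A common criterion for equality in [prod_val_cube_le], met by both the cube embedding and the
    dictator. *)
Lemma prod_val_cube_eq (k : nat) (g : 'I_N -> 'I_k -> R) (D : cube -> cube -> R) :
  (forall u v, dotp (g u) (g v) = D (vert u) (vert v)) ->
  (forall x, D x x = 1) -> (forall x, \sum_y noise rho x y * D x y = rho) ->
  prod_val cube_weight g = 1 / 4 - 1 / 4 * loopless_corr.
Proof.
move=> gD D1 Drho; rewrite prod_val_cubeE edge_exp_cube.
have p1 := loop_mass_lt1; congr (_ - _ * _).
rewrite (eq_bigr (fun=> rho)); last first.
  move=> u _; under eq_bigr do rewrite gD.
  by rewrite (noise_row u (D (vert u))).
rewrite [X in loop_mass * X](eq_bigr (fun=> 1)); last by move=> u _; rewrite gD D1.
rewrite !sumr_const card_ord -[rho *+ _]mulr_natr -mulrBl /loopless_corr.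
by rewrite invfM mulrA mulfK// gt_eqF.
Qed.

(** The point [x / sqrt d], padded with zeros from [d] to [N] coordinates; there is room since [N]
    is [2 ^ d]. *)
Definition cube_embedding (u k : 'I_N) : R :=
  oapp (fun i : 'I_d => sg (vert u i)) 0 (insub (k : nat)) / Num.sqrt d%:R.

Lemma dotp_cube_embedding u v :
  dotp (cube_embedding u) (cube_embedding v) = cube_corr (vert u) (vert v).
Proof.
pose a (u : 'I_N) (k : nat) : R := oapp (fun i : 'I_d => sg (vert u i)) 0 (insub k).
have dN : (d <= N)%N by rewrite card_ffun card_bool card_ord ltnW// ltn_expl.
rewrite /dotp /cube_embedding /cube_corr.
transitivity ((\sum_(k < N) a u k * a v k) / d%:R).
  rewrite mulr_suml; apply: eq_bigr => k _; rewrite mulrACA -invfM -expr2.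
  by rewrite sqr_sqrtr ?ler0n.
congr (_ / _); transitivity (\sum_(k < d) a u k * a v k); last first.
  by apply: eq_bigr => i _; rewrite /a !valK.
rewrite (big_ord_widen N (fun k => a u k * a v k) dN) [RHS]big_mkcond/=.
by apply: eq_bigr => k _; case: ifPn => // kd; rewrite /a insubN// mul0r.
Qed.

Lemma cube_corr_id (x : cube) : cube_corr x x = 1 :> R.
Proof.
rewrite /cube_corr; under eq_bigr do rewrite -expr2 sqrr_sign.
by rewrite sumr_const card_ord divff// pnatr_eq0.
Qed.

Lemma unit_sphere_cube_embedding u : unit_sphere (cube_embedding u).
Proof. by apply/unit_sphere_dotp; rewrite dotp_cube_embedding cube_corr_id. Qed.

Lemma SDP_Prod_optimal_cube : SDP_Prod_optimal cube_weight cube_embedding.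
Proof.
split=> [|g g1]; first exact: unit_sphere_cube_embedding.
rewrite (prod_val_cube_eq dotp_cube_embedding cube_corr_id); last first.
  by move=> x; exact: sum_noise_corr.
by apply: prod_val_cube_le => u; have /unit_sphere_dotp -> := g1 u.
Qed.

Lemma Prod_cube_ge : 1 / 4 - 1 / 4 * loopless_corr <= Prod cube_weight.
Proof.
pose dict (u : 'I_N) (k : 'I_3) : R := if k == ord0 then sg (vert u ord0) else 0.
have dictE u v : dotp (dict u) (dict v) = sg (vert u ord0) * sg (vert v ord0).
  by rewrite /dotp (bigD1 ord0)//= big1 ?addr0// => k /negPf k0;
    rewrite /dict k0 mul0r.
rewrite -(prod_val_cube_eq (D := fun x y => sg (x ord0) * sg (y ord0)) dictE);
  [|by move=> x; rewrite -expr2 sqrr_sign|by move=> x; exact: sum_noise_sign].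
(* The upper bound on [prod_val] guarantees that [sup] is taken over a bounded set. *)
apply: ub_le_sup.
  exists (1 / 4 - 1 / 4 * loopless_corr) => _ [g g1 <-].
  by apply: prod_val_cube_le => u; have /unit_sphere_dotp -> := g1 u.
exists dict => // u; apply/unit_sphere_dotp.
by rewrite dictE -expr2 sqrr_sign.
Qed.

End cube_graph.

(** * Rounding on the hypercube graph *)

Section edge_rounding.
Context {R : realType}.
Variables (N : nat) (w : 'I_N -> 'I_N -> R) (f : 'I_N -> 'I_N -> R).
Hypothesis f1 : forall u, unit_sphere (f u).

Let rnd (e : 'I_N * 'I_N) (g : nat -> R) : R :=
  let Z := \matrix_(i < 3, j < N) g (i * N + j)%N in
  1 / 4 - 1 / 4 * dotp (normalize (mxvec_mul Z (f e.1)))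
                       (normalize (mxvec_mul Z (f e.2))).

Let mrnd e : coord_measurable (rnd e).
Proof.
move=> d T X mX; apply: measurable_funB => //; apply: measurable_funM => //.
exact: (@coord_measurable_rounding R 3 N (f e.1) (f e.2) d T X mX).
Qed.

Let brnd e : exists M : R, forall g, `|rnd e g| <= M.
Proof.
exists 1 => g; rewrite /rnd /=; set Z := \matrix_(_, _) _.
have := ler_norm_dotp_normalize (mxvec_mul Z (f e.1)) (mxvec_mul Z (f e.2)).
by rewrite !ler_norml => /andP[a b]; lra.
Qed.

Let gauss_exp_rnd e :
  gauss_exp (3 * N) (rnd e) = 1 / 4 - 1 / 4 * Fstar 3 (dotp (f e.1) (f e.2)).
Proof.
(* A family with two members presents the integrand as a linear combination of the constant one and
   the rounded inner product, as [gauss_exp_sum] requires. *)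
pose F (t : bool) (g : nat -> R) : R := if t then 1 else
  let Z := \matrix_(i < 3, j < N) g (i * N + j)%N in
  dotp (normalize (mxvec_mul Z (f e.1))) (normalize (mxvec_mul Z (f e.2))).
pose c (t : bool) : R := if t then 1 / 4 else - (1 / 4).
have mF t : coord_measurable (F t).
  case: t; last exact: coord_measurable_rounding.
  by move=> d T X _; exact: measurable_cst.
have bF t : exists M : R, forall g, `|F t g| <= M.
  exists 1 => g; case: t; first by rewrite normr1.
  exact: ler_norm_dotp_normalize.
have := gauss_exp_sum c mF bF (3 * N) [:: true; false].
rewrite !big_cons big_nil addr0 gauss_exp_cst mulr1 /= mulNr.
rewrite -(gauss_mx_exp_rounding (f1 e.1) (f1 e.2)) => <-.
congr gauss_exp; apply/funext => g.
by rewrite !big_cons big_nil addr0 mulr1 mulNr.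
Qed.

Lemma gauss_mx_exp_edge :
  gauss_mx_exp (fun Z : 'M[R]_(3, N) => edge_exp w (fun u v =>
    1 / 4 - 1 / 4 * dotp (normalize (mxvec_mul Z (f u)))
                         (normalize (mxvec_mul Z (f v))))) =
  edge_exp w (fun u v => 1 / 4 - 1 / 4 * Fstar 3 (dotp (f u) (f v))).
Proof.
rewrite /edge_exp pair_bigA/= /gauss_mx_exp.
transitivity (\sum_e w e.1 e.2 * gauss_exp (3 * N) (rnd e)); last first.
  by apply: eq_bigr => e _; rewrite gauss_exp_rnd.
rewrite -(gauss_exp_sum (fun e => w e.1 e.2) mrnd brnd).
by congr gauss_exp; apply/funext => g; rewrite pair_bigA.
Qed.

(** The left side is the expected value of the rounded assignment, so a bound holding for every
    outcome [Z] carries over to it. *)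
Lemma edge_exp_Fstar_le (B : R) :
  (forall Z : 'M[R]_(3, N),
    prod_val w (fun u => normalize (mxvec_mul Z (f u))) <= B) ->
  edge_exp w (fun u v => 1 / 4 - 1 / 4 * Fstar 3 (dotp (f u) (f v))) <= B.
Proof.
move=> wB; rewrite /edge_exp pair_bigA/=.
under eq_bigr do rewrite -gauss_exp_rnd.
apply: (gauss_exp_sum_le mrnd brnd) => g.
have := wB (\matrix_(i < 3, j < N) g (i * N + j)%N).
by rewrite /prod_val /edge_exp pair_bigA.
Qed.

End edge_rounding.

Section cube_rounding.
Context {R : realType}.

Definition noise_Fstar (m : nat) (rho : R) : R :=
  (\sum_(x : {ffun 'I_m.+1 -> bool}) \sum_y
     noise rho x y * Fstar 3 (cube_corr x y)) / #|{ffun 'I_m.+1 -> bool}|%:R.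

Variable (m : nat) (rho : R).
Hypothesis rho_le0 : -1 <= rho <= 0.
Local Notation p := (loop_mass m rho).
Local Notation cube := {ffun 'I_m.+1 -> bool}.

Let card_gt0 : 0 < #|{: cube}|%:R :> R.
Proof. by rewrite ltr0n card_ffun card_bool card_ord expn_gt0. Qed.

Lemma edge_exp_cube_Fstar :
  edge_exp (@cube_weight R m rho) (fun u v => 1 / 4 - 1 / 4 *
    Fstar 3 (dotp (cube_embedding u) (cube_embedding v))) =
  1 / 4 - 1 / 4 * ((noise_Fstar m rho - p * Fstar 3 1) / (1 - p)).
Proof.
have p1 := loop_mass_lt1 m rho_le0.
rewrite edge_exp_cube.
have -> : \sum_u (1 / 4 - 1 / 4 * Fstar 3
    (dotp (@cube_embedding R m u) (cube_embedding u))) =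
    #|{: cube}|%:R * (1 / 4 - 1 / 4 * Fstar 3 1).
  rewrite (eq_bigr (fun=> 1 / 4 - 1 / 4 * Fstar 3 1)).
    by rewrite sumr_const card_ord -[LHS]mulr_natl.
  by move=> u _; rewrite dotp_cube_embedding cube_corr_id.
have -> : \sum_u \sum_v noise rho (vert u) (vert v) * (1 / 4 - 1 / 4 * Fstar 3
    (dotp (@cube_embedding R m u) (cube_embedding v))) =
    #|{: cube}|%:R * (1 / 4 - 1 / 4 * noise_Fstar m rho).
  have NS : #|{: cube}|%:R * noise_Fstar m rho =
      \sum_(x : cube) \sum_y noise rho x y * Fstar 3 (cube_corr x y).
    by rewrite /noise_Fstar mulrC divfK ?gt_eqF.
  rewrite mulrBr [_ * (_ * noise_Fstar _ _)]mulrCA NS.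
  rewrite -(sum_vert (fun x => \sum_y noise rho x y * Fstar 3 (cube_corr x y))).
  transitivity (\sum_(u < #|{: cube}|) (1 / 4 - 1 / 4 *
      \sum_y noise rho (vert u) y * Fstar 3 (cube_corr (vert u) y))); last first.
    by rewrite sumrB sumr_const card_ord -[_ *+ #|_|]mulr_natl -mulr_sumr.
  apply: eq_bigr => u _.
  rewrite -(noise_row rho u (fun y => Fstar 3 (cube_corr (vert u) y))).
  rewrite -[X in X - _]mulr1 -(sum_noise rho (vert u)).
  rewrite -(sum_vert (noise rho (vert u))) -mulrBr -sumrB mulr_sumr.
  by apply: eq_bigr => v _; rewrite dotp_cube_embedding; ring.
by field; rewrite !gt_eqF// subr_gt0.
Qed.

(** Rounding cannot exceed the bound of [prod_val_cube_le]. Clearing [1 - p] leaves [rho - p <=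
    noise_Fstar m rho - p * Fstar 3 1], and [Fstar 3 1 >= -1] costs the second [p]. *)
Lemma noise_Fstar_ge : rho - 2 * p <= noise_Fstar m rho.
Proof.
have p0 := loop_mass_ge0 m rho_le0; have p1 := loop_mass_lt1 m rho_le0.
have := @edge_exp_Fstar_le R _ (@cube_weight R m rho) _
  (@unit_sphere_cube_embedding R m) (1 / 4 - 1 / 4 * loopless_corr m rho).
rewrite edge_exp_cube_Fstar => H.
have {}H : loopless_corr m rho <= (noise_Fstar m rho - p * Fstar 3 1) / (1 - p).
  suff : 1 / 4 - 1 / 4 * ((noise_Fstar m rho - p * Fstar 3 1) / (1 - p)) <=
    1 / 4 - 1 / 4 * loopless_corr m rho by lra.
  apply: H => Z; apply: prod_val_cube_le => // u; exact: dotp_normalize_le1.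
move: H; rewrite /loopless_corr ler_pM2r ?invr_gt0 ?subr_gt0//.
have := Fstar_le1 3 (1 : R); rewrite ler_norml => /andP[a b] H.
by nra.
Qed.

Lemma noise_Fstar_dist (e del : R) : 0 < del -> 0 <= e ->
  (forall s, `|s - rho| < del -> `|Fstar 3 s - Fstar 3 rho| <= e) ->
  `|noise_Fstar m rho - Fstar 3 rho| <= e + 2 / del ^+ 2 / m.+1%:R.
Proof.
move=> del0 e0; rewrite /noise_Fstar.
move: (@Fstar R 3) (@Fstar_le1 R 3) => F F1 Fe.
have rho1 : -1 <= rho <= 1 by case/andP: rho_le0 => r1 r0; lra.
pose c (x y : cube) : R := cube_corr x y.
(* As in Chebyshev's inequality: within [del] of [rho] continuity gives [e]; farther away the
   trivial bound [2] is at most the quadratic term. *)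
have pt (x y : cube) : `|F (c x y) - F rho| <=
    e + 2 / del ^+ 2 * (c x y - rho) ^+ 2.
  have d2 : 0 < del ^+ 2 by rewrite exprn_gt0.
  have [/Fe h|h] := ltrP `|c x y - rho| del.
    apply: le_trans h _; rewrite lerDl mulr_ge0 ?sqr_ge0// divr_ge0//.
    exact: ltW.
  apply: (@le_trans _ _ 2).
    apply: le_trans (ler_normB _ _) _.
    by apply: le_trans (lerD (F1 (c x y)) (F1 rho)) _; lra.
  apply: (@le_trans _ _ (2 / del ^+ 2 * del ^+ 2)); first by rewrite divfK ?gt_eqF.
  apply: (@le_trans _ _ (2 / del ^+ 2 * (c x y - rho) ^+ 2)); last by rewrite lerDr.
  apply: ler_wpM2l; first by rewrite divr_ge0// ltW.
  rewrite -[leRHS]real_normK ?num_real//.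
  by rewrite lerXn2r ?nnegrE// ltW.
have row (x : cube) : `|\sum_y noise rho x y * F (c x y) - F rho| <=
    e + 2 / del ^+ 2 / m.+1%:R.
  have -> : \sum_y noise rho x y * F (c x y) - F rho =
      \sum_y noise rho x y * (F (c x y) - F rho).
    under [RHS]eq_bigr do rewrite mulrBr.
    by rewrite sumrB -mulr_suml sum_noise mul1r.
  apply: le_trans (ler_norm_sum _ _ _) _.
  apply: (@le_trans _ _ (\sum_y noise rho x y *
      (e + 2 / del ^+ 2 * (c x y - rho) ^+ 2))).
    apply: ler_sum => y _; rewrite normrM ger0_norm ?noise_ge0//.
    by rewrite ler_wpM2l ?noise_ge0.
  under eq_bigr do rewrite mulrDr mulrCA.
  rewrite big_split/= -mulr_suml sum_noise mul1r -mulr_sumr lerD2l.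
  rewrite ler_wpM2l ?divr_ge0 ?sqr_ge0//.
  exact: noise_concentration.
have -> : (\sum_(x : cube) \sum_y noise rho x y * F (cube_corr x y)) /
      #|{: cube}|%:R - F rho =
    (\sum_(x : cube) (\sum_y noise rho x y * F (c x y) - F rho)) /
      #|{: cube}|%:R.
  by rewrite sumrB sumr_const -[F rho *+ _]mulr_natr mulrBl mulfK ?gt_eqF.
rewrite normrM normfV (ger0_norm (ltW card_gt0)) ler_pdivrMr//.
apply: le_trans (ler_norm_sum _ _ _) _.
apply: (@le_trans _ _ (\sum_(x : cube) (e + 2 / del ^+ 2 / m.+1%:R))).
  by apply: ler_sum => x _; exact: row.
by rewrite sumr_const -[(e + _) *+ _]mulr_natr.
Qed.

End cube_rounding.

(** * Growing dimension *)

Section limit.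
Context {R : realType}.

Lemma noise_Fstar_approx (rho e : R) : -1 <= rho <= 0 -> 0 < e ->
  exists m, `|noise_Fstar m rho - Fstar 3 rho| <= e /\ loop_mass m rho <= e.
Proof.
move=> rho0 e0.
have rho1 : -1 <= rho <= 1 by case/andP: rho0 => r1 r0; lra.
have e20 : 0 < e / 2 by rewrite divr_gt0.
have := continuous_Fstar3 rho1 => /cvgrPdist_lt /(_ _ e20) /nbhs_ballP[del /= del0 Fdel].
have d20 : 0 < del ^+ 2 by rewrite exprn_gt0.
(* The first summand makes the Chebyshev term at most [e / 2]; the second makes [2 ^- m.+1], which
   bounds the loop mass, at most [e]. *)
pose K := 2 / del ^+ 2 / (e / 2) + e^-1.
have K1 : 0 <= 2 / del ^+ 2 / (e / 2) by rewrite !divr_ge0 ?ltW.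
have K2 : 0 <= e^-1 by rewrite invr_ge0 ltW.
have K0 : 0 <= K by rewrite addr_ge0.
pose m := Num.bound K; exists m.
have Km : K <= m.+1%:R.
  by apply: le_trans (ltW (archi_boundP K0)) _; rewrite ler_nat.
have m0 : 0 < m.+1%:R :> R by rewrite ltr0n.
split.
  have -> : e = e / 2 + e / 2 by rewrite -splitr.
  apply: (@le_trans _ _ (e / 2 + 2 / del ^+ 2 / m.+1%:R)).
    apply: noise_Fstar_dist => //; first exact: ltW.
    move=> s sd; rewrite distrC ltW//; apply: Fdel.
    by rewrite /ball/= distrC.
  rewrite lerD2l ler_pdivrMr// -ler_pdivrMl// [leLHS]mulrC.
  by apply: le_trans _ Km; rewrite lerDl.
apply: le_trans (loop_mass_le m rho0) _.
rewrite exprVn invf_ple ?posrE ?exprn_gt0//.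
apply: (@le_trans _ _ m.+1%:R); first by apply: le_trans _ Km; rewrite lerDr.
by rewrite -natrX ler_nat ltnW// ltn_expl.
Qed.

(** Let the dimension grow in [noise_Fstar_ge] at parameter [- rho], then use oddness. *)
Lemma Fstar3_le (rho : R) : 0 <= rho <= 1 -> Fstar 3 rho <= rho.
Proof.
move=> /andP[r0 r1].
rewrite -[leLHS]opprK -Fstar3_opp; last by apply/andP; split; lra.
rewrite lerNl; apply/ler_addgt0Pr => e e0.
have rho0 : -1 <= - rho <= 0 by apply/andP; split; lra.
(* One third pays for the averaging error and two thirds for twice the loop mass. *)
have e30 : 0 < e / 3 by rewrite divr_gt0.
have [m [+ pm]] := noise_Fstar_approx rho0 e30.
have := noise_Fstar_ge m rho0; move: pm.
move: (noise_Fstar _ _) (Fstar _ _) (loop_mass _ _) => A F p.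
by rewrite ler_norml => pe Ap /andP[a b]; lra.
Qed.

End limit.

Theorem theorem2p9 (R : realType) (eps : R) (heps : 0 < eps) :
  exists (N : nat) (w : 'I_N -> 'I_N -> R) (fSDP : 'I_N -> 'I_N -> R),
    weighted_graph w /\ no_self_loops w /\ SDP_Prod_optimal w fSDP /\
    gauss_mx_exp (fun Z : 'M[R]_(3, N) =>
      edge_exp w (fun u v =>
        1/4 - 1/4 * dotp (normalize (mxvec_mul Z (fSDP u)))
                         (normalize (mxvec_mul Z (fSDP v)))))
    <= (alpha_BOV R + eps) * Prod w.
Proof.
suff [m [rho [rho0 bound]]] : exists m (rho : R), -1 <= rho <= 0 /\
    edge_exp (@cube_weight R m rho) (fun u v => 1 / 4 - 1 / 4 *
      Fstar 3 (dotp (cube_embedding u) (cube_embedding v))) <=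
    (alpha_BOV R + eps) * Prod (@cube_weight R m rho).
  exists #|{: {ffun 'I_m.+1 -> bool}}|, (@cube_weight R m rho), (@cube_embedding R m).
  split; first exact: weighted_graph_cube.
  split; first exact: no_self_loops_cube.
  split; first exact: SDP_Prod_optimal_cube.
  by rewrite (gauss_mx_exp_edge _ (@unit_sphere_cube_embedding R m)).
pose ratio (rho : R) := (1 / 4 - 1 / 4 * Fstar 3 rho) / (1 / 4 - 1 / 4 * rho).
have F1 (rho : R) : Fstar 3 rho <= 1.
  by have := Fstar_le1 3 rho; rewrite ler_norml => /andP[].
have has_inf_ratio : has_inf [set ratio rho | rho in
    [set rho : R | -1 <= rho /\ rho < 1]].
  split; first by exists (ratio 0), 0 => //; split; lra.
  exists 0 => _ [rho [r1 r2] <-]; have := F1 rho.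
  rewrite /ratio; move: (Fstar 3 rho) => F F1'.
  by rewrite divr_ge0//; lra.
have [_ [rho [r1 r2] <-] lt_ratio] := inf_adherent heps has_inf_ratio.
rewrite -/(alpha_BOV R) in lt_ratio.
have {has_inf_ratio} : ratio rho < alpha_BOV R + eps by exact: lt_ratio.
move: (alpha_BOV R + eps) => c {lt_ratio} ratio_lt.
have B0 : 0 < 1 / 4 - 1 / 4 * rho by lra.
have [rho_ge0|rho_lt0] := lerP 0 rho.
  have c1 : 1 <= c.
    apply: le_trans _ (ltW ratio_lt); rewrite /ratio ler_pdivlMr// mul1r.
    have : Fstar 3 rho <= rho by apply: Fstar3_le; apply/andP; split => //; exact: ltW.
    by move: (Fstar 3 rho) => F; lra.
  have m1 : -1 <= (-1 : R) <= 0 by apply/andP; split; lra.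
  (* The cube of dimension one at [rho = -1] is a single edge. Since [c >= 1], it is enough that
     rounding stays below [Prod] and that [Prod] is nonnegative. *)
  exists 0%N, (-1); split => //.
  have Pge := Prod_cube_ge 0 m1.
  apply: (@le_trans _ _ (Prod (@cube_weight R 0 (-1)))).
    apply: le_trans _ Pge; apply: edge_exp_Fstar_le.
      exact: unit_sphere_cube_embedding.
    by move=> Z; apply: prod_val_cube_le => // u; exact: dotp_normalize_le1.
  rewrite ler_peMl//; apply: le_trans _ Pge.
  have p0 := loop_mass_ge0 0 m1; have p1 := loop_mass_lt1 0 m1.
  have : loopless_corr 0 (-1 : R) <= 0.
    by rewrite /loopless_corr pmulr_lle0 ?invr_gt0 ?subr_gt0//; lra.
  lra.
have rho0 : -1 <= rho <= 0 by rewrite r1 ltW.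
pose A := 1 / 4 - 1 / 4 * Fstar 3 rho.
pose B := 1 / 4 - 1 / 4 * rho.
have A0 : 0 <= A by have := F1 rho; rewrite /A; move: (Fstar 3 rho) => F; lra.
have AcB : A < c * B by move: ratio_lt; rewrite /ratio ltr_pdivrMr.
have cB0 : 0 < c * B by exact: le_lt_trans AcB.
have c0 : 0 <= c by rewrite -(pmulr_lge0 _ B0) ltW.
(* Chosen so that [A + e / 4 = c * B - e * (c * B)]: the left side absorbs the error in the average,
   the right side the factor [1 - loop_mass]. *)
pose e := (c * B - A) / (1 / 4 + c * B).
have D0 : 0 < 1 / 4 + c * B by lra.
have e0 : 0 < e by rewrite divr_gt0// subr_gt0.
have eE : e * (1 / 4 + c * B) = c * B - A by rewrite /e divfK// gt_eqF.
have [m [dist pe]] := noise_Fstar_approx rho0 e0.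
exists m, rho; split => //.
have p0 := loop_mass_ge0 m rho0; have p1 := loop_mass_lt1 m rho0.
apply: (@le_trans _ _ (c * B)); last first.
  rewrite ler_wpM2l//; apply: le_trans _ (Prod_cube_ge m rho0).
  (* Loops have correlation one, so deleting them only lowers the mean correlation and [Prod] is at
     least [B]. *)
  have : loopless_corr m rho <= rho.
    rewrite /loopless_corr ler_pdivrMr ?subr_gt0//; nra.
  by rewrite /B; lra.
rewrite edge_exp_cube_Fstar//.
have := F1 1; have := dist; rewrite ler_norml => /andP[+ _].
move: eE; rewrite /A.
move: (noise_Fstar m rho) (Fstar 3 rho) (Fstar 3 1) => avg F Fone eE av Fone1.
have -> : 1 / 4 - 1 / 4 * ((avg - loop_mass m rho * Fone) / (1 - loop_mass m rho)) =
    (1 / 4 * (1 - loop_mass m rho) - 1 / 4 * (avg - loop_mass m rho * Fone)) /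
    (1 - loop_mass m rho) by field; rewrite gt_eqF// subr_gt0.
rewrite ler_pdivrMr ?subr_gt0//.
move: (loop_mass m rho) p0 p1 pe => p p0 p1 pe.
(* This cancels the loop terms of the numerator, leaving at most [1 / 4 - 1 / 4 * avg]. *)
have h1 : p * Fone <= p by rewrite ler_piMr.
have h2 : p * (c * B) <= e * (c * B) by rewrite ler_wpM2r// ltW.
lra.
Qed.
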